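(* Let $X\subseteq\mathbb{R}^n$ be a nonempty bounded set that is the intersection of finitely many open half-spaces (a polyhedral Hilbert geometry), equipped with its Hilbert metric $d_X$. Let $\mathrm{Isom}(X)$ be the group of isometries of $(X,d_X)$ onto itself and $\mathrm{Coll}(X)=\{h\in \mathrm{PGL}(n+1,\mathbb{R})\colon h(X)=X\}$ the group of collineations of $X$. Then $\mathrm{Isom}(X)=\mathrm{Coll}(X)$ if and only if $X$ is not an open $n$-simplex with $n\geq 2$.
   Context: For an open bounded convex set $X\subseteq\mathbb{R}^n$, the Hilbert metric is $d_X(x,x)=0$ and, for $x\neq y$ in $X$, $d_X(x,y)=\log\frac{|x'y|\,|y'x|}{|x'x|\,|y'y|}$, where $x',y'$ are the points where the straight line through $x,y$ meets $\partial X$, labelled so that $x',x,y,y'$ lie on the line in this order, and $|ab|$ denotes Euclidean distance. $\mathbb{R}^n$ is regarded as the standard affine chart of real projective space $\mathbb{P}^n$, and collineations are projective transformations of $\mathbb{P}^n$; every collineation mapping $X$ onto $X$ is an isometry of $d_X$. An open $n$-simplex is the interior of the convex hull of $n+1$ affinely independent points of $\mathbb{R}^n$. *)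

(* Defs.v *)
From HB Require Import structures.
From mathcomp Require Import all_boot all_order all_algebra.
From mathcomp Require Import all_classical all_reals all_analysis.
Set Implicit Arguments. Unset Strict Implicit. Unset Printing Implicit Defensive.
Import Order.TTheory GRing.Theory Num.Theory.
Import numFieldNormedType.Exports.
Local Open Scope classical_set_scope.
Local Open Scope ring_scope.

Section HilbertDefs.
Variables (R : realType) (n : nat).
Implicit Types (X : set 'rV[R]_n) (x y : 'rV[R]_n).

Definition edist (a b : 'rV[R]_n) : R :=
  Num.sqrt (\sum_(i < n) (a 0 i - b 0 i) ^+ 2).

Definition dotv (a x : 'rV[R]_n) : R := \sum_(i < n) a 0 i * x 0 i.

Definition polyhedral X : Prop :=
  exists (k : nat) (a : 'I_k -> 'rV[R]_n) (b : 'I_k -> R),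
    (forall i, a i != 0) /\ X = [set x | forall i, dotv (a i) x < b i].

Definition ebounded X : Prop := exists r : R, forall x, X x -> edist x 0 <= r.

Definition bdry X : set 'rV[R]_n := closure X `\` X^°.

(* Hilbert metric: d_X(x,x) = 0, and for x <> y,
   log (|x'y| |y'x|) / (|x'x| |y'y|), where x', y' are the points where the
   line through x, y meets the boundary, in the order x', x, y, y'. *)
Definition hilbert_dist X x y : R :=
  if x == y then 0 else
  xget 0 [set d : R | exists x' y' : 'rV[R]_n,
     [/\ bdry X x', bdry X y',
         (exists2 s : R, 0 < s & x' = x + s *: (x - y)),
         (exists2 t : R, 0 < t & y' = y + t *: (y - x)) &
         d = ln ((edist x' y * edist y' x) / (edist x' x * edist y' y))]].

(* isometries of (X, d_X) onto itself (only the values on X matter) *)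
Definition is_isometry X (f : 'rV[R]_n -> 'rV[R]_n) : Prop :=
  [/\ (forall x, X x -> X (f x)),
      (forall y, X y -> exists2 x, X x & f x = y) &
      (forall x y, X x -> X y -> hilbert_dist X (f x) (f y) = hilbert_dist X x y)].

(* homogeneous coordinates of x in the standard affine chart: [x : 1] *)
Definition hom x : 'rV[R]_(n + 1) := row_mx x (const_mx 1).

(* the projective transformation induced by the invertible matrix M
   (acting on row vectors) sends [x:1] to [y:1] *)
Definition proj_maps (M : 'M[R]_(n + 1)) x y : Prop :=
  exists2 c : R, c != 0 & hom x *m M = c *: hom y.

Definition is_collineation X (M : 'M[R]_(n + 1)) : Prop :=
  [/\ M \in unitmx,
      (forall x, X x -> exists2 y, X y & proj_maps M x y) &
      (forall y, X y -> exists2 x, X x & proj_maps M x y)].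

Definition induced_by_collineation X (f : 'rV[R]_n -> 'rV[R]_n) : Prop :=
  exists M, is_collineation X M /\ forall x, X x -> proj_maps M x (f x).

Definition conv_hull (m : nat) (v : 'I_m -> 'rV[R]_n) : set 'rV[R]_n :=
  [set x | exists lam : 'I_m -> R,
     [/\ (forall i, 0 <= lam i), \sum_(i < m) lam i = 1 &
         x = \sum_(i < m) lam i *: v i]].

Definition aff_indep (v : 'I_n.+1 -> 'rV[R]_n) : Prop :=
  row_free (\matrix_(i < n) (v (lift ord0 i) - v ord0)).

Definition open_simplex X : Prop :=
  exists v : 'I_n.+1 -> 'rV[R]_n, aff_indep v /\ X = (conv_hull v)^°.

End HilbertDefs.

(* Main.v *)
(* Pass to the open cone over [X] in homogeneous coordinates, cut out by irredundant
   facet forms [h_i]; there the Hilbert distance of [x] and [y] is the logarithm of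
   [max_(i,j) (h_i x h_j y) / (h_i y h_j x)].

   Let [f] be an isometry. If a chord through [x] joins the relative interiors of the
   facets [i] and [j], then near [x] the distance to a suitable point is realised by the
   pair [(i,j)] only, and comparing distances before and after [f] gives a pair [(p,q)]
   with [h_p / h_q] at [f x] proportional to [h_i / h_j] at [x]. As the points seeing
   [(i,j)] form a convex set, [(p,q)] depends on [(i,j)] only.

   Fix a facet [i]. If [j] and [l] both share a ridge with [i], some point sees [(i,j)],
   [(i,l)] and [(j,l)], and [(h_i/h_j)(h_j/h_l) = h_i/h_l] forces the pairs assigned to
   [(i,j)] and [(i,l)] to share their first or their second index. Hence over all such
   [j] either the first indices agree, and then [f] is linear in homogeneous coordinates
   near the facet [i], or the second ones do, and then [f] inverts the coordinates
   [h_j / h_i]. In the second case a linear relation among the facet forms becomes an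
   impossible identity between partial fractions; a relation exists unless [X] is a
   simplex. In the first case the linear map permutes the facet forms up to scaling, so
   it preserves the cone, and an isometry that is the identity on an open set is the
   identity.

   On a simplex of dimension at least two, inverting the barycentric coordinates is an
   isometry that is not a collineation. *)

Require Import Defs.
From HB Require Import structures.
From mathcomp Require Import all_boot all_order all_algebra.
From mathcomp Require Import all_classical all_reals all_analysis.
From mathcomp Require Import ring lra.
Import Order.TTheory GRing.Theory Num.Theory.

Set Implicit Arguments. Unset Strict Implicit. Unset Printing Implicit Defensive.
Local Open Scope ring_scope.

(** * Finite families of inequalities and connectedness of the unit interval *)

Section Finite.
Variable R : realType.

(** The minimum of finitely many thresholds serves all; the term [b + 1] keeps it above [b] when [T]
    is empty. *)
Lemma uniform_gt (T : finType) (b : R) (P : T -> R -> Prop) :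
  (forall t r r', b < r' -> r' <= r -> P t r -> P t r') ->
  (forall t, exists2 r, b < r & P t r) -> exists2 r, b < r & forall t, P t r.
Proof.
move=> Pmono ex.
have /choice[g hg] : forall t, exists r, b < r /\ P t r.
  by move=> t; have [r br Pr] := ex t; exists r.
have gb t : b < g t by case: (hg t).
have Pg t : P t (g t) by case: (hg t).
exists (\big[Num.min/(b + 1)]_t g t).
  by apply: lt_bigmin => [|t _]; rewrite ?ltrDl ?ltr01 ?gb.
move=> t; apply: Pmono (Pg t); last exact: bigmin_le.
by apply: lt_bigmin => [|s _]; rewrite ?ltrDl ?ltr01 ?gb.
Qed.

Lemma small_pos (T : finType) (u v : T -> R) : (forall t, 0 < u t) ->
  exists2 e, 0 < e & forall s, 0 <= s -> s <= e -> forall t, 0 < u t + s * v t.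
Proof.
move=> u0.
have [||e e0 he] := @uniform_gt T 0
  (fun t e => forall s, 0 <= s -> s <= e -> 0 < u t + s * v t).
- by move=> t r r' _ rr h s s0 sr; apply: h => //; apply: le_trans rr.
- move=> t; have d0 : 0 < `|v t| + 1 by rewrite ltr_wpDl.
  (* Adding 1 avoids a zero denominator and makes the final inequality strict. *)
  exists (u t / (`|v t| + 1)); first by rewrite divr_gt0.
  move=> s s0; rewrite ler_pdivlMr // mulrDr mulr1 => hs.
  have [->|sn0] := eqVneq s 0; first by rewrite mul0r addr0.
  have sp : 0 < s by rewrite lt_def sn0.
  have : - (s * `|v t|) <= s * v t.
    by rewrite -mulrN ler_pM2l // lerNl (le_trans (ler_norm _)) ?normrN.
  move=> hv; lra.
by exists e => // s s0 se t; apply: he.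
Qed.

Lemma argmaxP (T : finType) (i0 : T) (F : T -> R) :
  exists i, forall j, F j <= F i.
Proof.
case: (@Order.TotalTheory.arg_maxP _ R T i0 xpredT F) => // i _ h.
by exists i => j; apply: h.
Qed.

Lemma sqrt_gt1 (r : R) : 1 < r -> exists2 s, 1 < s & s * s <= r.
Proof.
move=> r1; exists (Num.sqrt r); first by rewrite -sqrtr1 ltr_sqrt //; lra.
by rewrite -expr2 sqr_sqrtr //; lra.
Qed.

Lemma other_index k (i : 'I_k) : (1 < k)%N -> exists j : 'I_k, j != i.
Proof.
move=> k1; have [i0|i0] := eqVneq i (Ordinal (ltnW k1)).
  by exists (Ordinal k1); rewrite i0.
by exists (Ordinal (ltnW k1)); rewrite eq_sym.
Qed.

Lemma convex_comb_gt0 (s t x y : R) : 0 <= s -> 0 <= t -> 0 < s + t ->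
  0 < x -> 0 < y -> 0 < s * x + t * y.
Proof.
move=> s0 t0 st x0 y0; have [s1|] := ltP 0 s.
  by rewrite ltr_pwDl ?mulr_gt0 // mulr_ge0 // ltW.
move=> s1; have t1 : 0 < t by lra.
by rewrite ltr_wpDl ?mulr_gt0 // mulr_ge0 // ltW.
Qed.

(** Connectedness of the interval: local constancy carries [Q] to the supremum of the times where it
    holds and, were this below 1, beyond it. *)
Lemma locally_constant_segment (Q : R -> Prop) :
  (forall t, 0 <= t <= 1 -> exists2 e, 0 < e &
     forall s s', 0 <= s <= 1 -> 0 <= s' <= 1 ->
       `|s - t| <= e -> `|s' - t| <= e -> Q s -> Q s') ->
  Q 0 -> Q 1.
Proof.
move=> lc Q0.
pose A := [set t | 0 <= t <= 1 /\ Q t]%classic.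
have A0 : A 0 by split; rewrite ?lexx ?ler01.
have hA : has_sup A.
  by split; [exists 0|exists 1 => t [/andP[]]].
have ub t : A t -> t <= sup A by move=> At; apply: ub_le_sup => //; case: hA.
have T0 : 0 <= sup A by apply: ub.
have T1 : sup A <= 1 by apply: ge_sup; [exists 0|move=> t [/andP[]]].
have [|e e0 he] := lc (sup A); first by rewrite T0.
have [s As hs] := sup_adherent e0 hA.
have hclose s' : 0 <= s' <= 1 -> `|s' - sup A| <= e -> Q s'.
  move=> s'1 hs'; case: (As) => s1 Qs; apply: he Qs => //.
  by have h := ub _ As; rewrite ler_norml; apply/andP; split; lra.
have [T1'|T1'] := ltP (sup A) 1; last first.
  have -> : (1 : R) = sup A by apply/eqP; rewrite eq_le T1 T1'.
  by apply: hclose; rewrite ?T0 // subrr normr0 ltW.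
have [le1|lt1] := leP 1 (sup A + e).
  by apply: hclose; rewrite ?ler01 ?lexx // ger0_norm; lra.
have : A (sup A + e).
  split; first by apply/andP; split; lra.
  apply: hclose; last by rewrite addrC addKr ger0_norm // ltW.
  by apply/andP; split; lra.
by move=> /ub; lra.
Qed.

End Finite.

(** * Functions that are polynomial along lines *)

Section PolynomialFunction.
Variables (R : realType) (V : lmodType R).

Definition polyfun (P : V -> R) :=
  forall x v, exists p : {poly R}, forall t, P (x + t *: v) = p.[t].

Lemma polyfunC c : polyfun (fun=> c).
Proof. by move=> x v; exists c%:P => t; rewrite hornerC. Qed.

Lemma polyfunD P Q : polyfun P -> polyfun Q -> polyfun (fun x => P x + Q x).
Proof.
move=> hP hQ x v; have [p Hp] := hP x v; have [q Hq] := hQ x v.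
by exists (p + q) => t; rewrite hornerD Hp Hq.
Qed.

Lemma polyfunM P Q : polyfun P -> polyfun Q -> polyfun (fun x => P x * Q x).
Proof.
move=> hP hQ x v; have [p Hp] := hP x v; have [q Hq] := hQ x v.
by exists (p * q) => t; rewrite hornerM Hp Hq.
Qed.

Lemma polyfunN P : polyfun P -> polyfun (fun x => - P x).
Proof.
by move=> hP x v; have [p Hp] := hP x v; exists (- p) => t; rewrite hornerN Hp.
Qed.

Lemma polyfun_sum I (r : seq I) (Q : pred I) (P : I -> V -> R) :
  (forall i, polyfun (P i)) -> polyfun (fun x => \sum_(i <- r | Q i) P i x).
Proof.
move=> hP x v.
pose hp i := cid (hP i x v).
exists (\sum_(i <- r | Q i) proj1_sig (hp i)) => t; rewrite horner_sum.
by apply: eq_bigr => i _; case: (hp i).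
Qed.

Lemma polyfun_prod I (r : seq I) (Q : pred I) (P : I -> V -> R) :
  (forall i, polyfun (P i)) -> polyfun (fun x => \prod_(i <- r | Q i) P i x).
Proof.
move=> hP x v.
pose hp i := cid (hP i x v).
exists (\prod_(i <- r | Q i) proj1_sig (hp i)) => t; rewrite horner_prod.
by apply: eq_bigr => i _; case: (hp i).
Qed.

(** A nonzero restriction to the line would have the roots [e / (m + 1)] for [m < size p], more than
    its degree allows. *)
Lemma polyfun_eq0 P x v e : polyfun P -> 0 < e ->
  (forall t, 0 <= t -> t <= e -> P (x + t *: v) = 0) -> P (x + v) = 0.
Proof.
move=> hP e0 h0; have [p hp] := hP x v.
suff p0 : p = 0 by rewrite -[v]scale1r hp p0 horner0.
apply/eqP/negPn/negP => pn0.
pose rs := [seq e / m.+1%:R | m <- iota 0 (size p)].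
have : (size rs < size p)%N.
  apply: max_poly_roots => //.
    apply/allP => r /mapP[m _ ->]; rewrite rootE -hp; apply/eqP/h0.
      by rewrite divr_ge0 ?ltW.
    by rewrite ler_pdivrMr ?ltr0n // ler_peMr ?ler1n // ltW.
  rewrite map_inj_uniq ?iota_uniq // => m m' /(mulfI (lt0r_neq0 e0))/invr_inj/eqP.
  by rewrite eqr_nat eqSS => /eqP.
by rewrite size_map size_iota ltnn.
Qed.

End PolynomialFunction.

(** * The cone over a polyhedron *)

Section Cone.
Variables (R : realType) (N k : nat) (H : 'M[R]_(N, k)).
Implicit Types (x y z v : 'rV[R]_N) (i j m p q : 'I_k) (r : R).

Definition lform j x : R := (x *m H) 0 j.

Local Notation h := lform.

Lemma lformD j x y : h j (x + y) = h j x + h j y.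
Proof. by rewrite /lform mulmxDl mxE. Qed.

Lemma lformN j x : h j (- x) = - h j x.
Proof. by rewrite /lform mulNmx mxE. Qed.

Lemma lformZ j r x : h j (r *: x) = r * h j x.
Proof. by rewrite /lform -scalemxAl mxE. Qed.

Lemma lform0 j : h j 0 = 0.
Proof. by rewrite /lform mul0mx mxE. Qed.

Lemma lform_polyfun j : polyfun (h j).
Proof.
move=> x v; exists ((h j x)%:P + (h j v)%:P * 'X) => t.
by rewrite lformD lformZ !hornerE mulrC.
Qed.

Definition cone x := forall j, 0 < h j x.

(** For irredundant forms this is the relative interior of the facet [i] of the cone. *)
Definition face i x := h i x = 0 /\ forall m, m != i -> 0 < h m x.

(* Up to scaling, [x] lies on a chord joining the relative interiors of the facets
   [i] and [j]. *)
Definition visible i j x := exists a b, [/\ face i a, face j b & x = a + b].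

(* With [x], [y] in the cone, this says that their Hilbert distance is at most [ln r]. *)
Definition hclose r x y :=
  forall i j, h i x * h j y <= r * (h i y * h j x).

(** The closed Hilbert ball of radius [ln r]; with multiplicative radii the triangle inequality
    becomes a product. *)
Definition hball x0 r x := cone x /\ hclose r x x0.

Definition same_ray x y := exists2 s, 0 < s & y = s *: x.

(** On the cone: the ratio [h m x / h m y] is largest at [m = p] only. *)
Definition strict_max p x y :=
  forall m, m != p -> h m x * h p y < h p x * h m y.

Lemma same_ray_refl x : same_ray x x. Proof. by exists 1; rewrite ?ltr01 ?scale1r. Qed.

Lemma same_ray_sym x y : same_ray x y -> same_ray y x.
Proof.
by case=> s s0 ->; exists s^-1; rewrite ?invr_gt0 // scalerA mulVf ?scale1r ?gt_eqF.
Qed.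

Lemma same_ray_trans x y z : same_ray x y -> same_ray y z -> same_ray x z.
Proof.
by case=> s s0 -> [t t0 ->]; exists (t * s); rewrite ?mulr_gt0 ?scalerA.
Qed.

Lemma cone_ray x y : same_ray x y -> cone x -> cone y.
Proof. by case=> s s0 -> cx j; rewrite lformZ mulr_gt0. Qed.

Lemma cone_convex x y s t : cone x -> cone y -> 0 <= s -> 0 <= t -> 0 < s + t ->
  cone (s *: x + t *: y).
Proof.
by move=> cx cy s0 t0 st j; rewrite lformD !lformZ convex_comb_gt0.
Qed.

Lemma face_convex i x y s t : face i x -> face i y -> 0 <= s -> 0 <= t ->
  0 < s + t -> face i (s *: x + t *: y).
Proof.
move=> [x0 fx] [y0 fy] s0 t0 st; split; rewrite ?lformD ?lformZ ?x0 ?y0 ?mulr0 ?addr0 //.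
by move=> m mi; rewrite lformD !lformZ convex_comb_gt0 ?fx ?fy.
Qed.

Lemma visible_convex i j x y s t : visible i j x -> visible i j y ->
  0 <= s -> 0 <= t -> 0 < s + t -> visible i j (s *: x + t *: y).
Proof.
move=> [a [b [fa fb ->]]] [a' [b' [fa' fb' ->]]] s0 t0 st.
exists (s *: a + t *: a'), (s *: b + t *: b').
by split; [exact: face_convex..|rewrite !scalerDr addrACA].
Qed.

Lemma visible_ray i j x y : same_ray x y -> visible i j x -> visible i j y.
Proof.
move=> [s s0 ->] vx; rewrite -[s *: x]addr0 -(scale0r x).
by apply: visible_convex; rewrite // ?addr0 ?ltW.
Qed.

Lemma visible_cone i j x : i != j -> visible i j x -> cone x.
Proof.
move=> ij [a [b [[a0 fa] [b0 fb] ->]]] m; rewrite lformD.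
have [->|mi] := eqVneq m i; first by rewrite a0 add0r fb.
have [->|mj] := eqVneq m j; first by rewrite b0 addr0 fa // eq_sym.
by rewrite addr_gt0 ?fa ?fb.
Qed.

Lemma same_ray_mul x y : same_ray x y -> cone x ->
  exists2 s, 0 < s & forall j, h j y = s * h j x.
Proof. by case=> s s0 -> cx; exists s => // j; rewrite lformZ. Qed.

Lemma hclose_rayl r x x' y : same_ray x x' -> hclose r x y -> hclose r x' y.
Proof.
move=> [s s0 ->] c i j; rewrite !lformZ -mulrA [h i y * _]mulrCA [r * _]mulrCA.
by rewrite ler_pM2l.
Qed.

Lemma hclose_rayr r x y y' : same_ray y y' -> hclose r x y -> hclose r x y'.
Proof.
move=> [s s0 ->] c i j; rewrite !lformZ -[s * _ * _]mulrA [h i x * _]mulrCA [r * _]mulrCA.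
by rewrite ler_pM2l.
Qed.

Lemma hclose_trans r s x y z : cone x -> cone y -> cone z -> 0 <= r -> 0 <= s ->
  hclose r x y -> hclose s y z -> hclose (r * s) x z.
Proof.
move=> cx cy cz r0 s0 xy yz i j.
have := ler_pM _ _ (xy i j) (yz i j).
have -> : h i x * h j y * (h i y * h j z) = h i x * h j z * (h i y * h j y) by ring.
have -> : r * (h i y * h j x) * (s * (h i z * h j y)) =
  r * s * (h i z * h j x) * (h i y * h j y) by ring.
by rewrite ler_pM2r ?mulr_gt0 //; apply; rewrite mulr_ge0 // ltW.
Qed.

Lemma hclose_mono r r' x y : cone x -> cone y -> r <= r' -> hclose r x y -> hclose r' x y.
Proof.
move=> cx cy rr c i j; apply: le_trans (c i j) _.
by rewrite ler_wpM2r // mulr_ge0 // ltW.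
Qed.

Lemma hclose_refl r x : cone x -> 1 <= r -> hclose r x x.
Proof. by move=> cx r1 i j; rewrite ler_peMl // mulr_ge0 // ltW. Qed.

Lemma hball_center r x : cone x -> 1 < r -> hball x r x.
Proof. by move=> cx r1; split=> //; apply: hclose_refl => //; apply: ltW. Qed.

Lemma hball_mono r r' x y : cone x -> r <= r' -> hball x r y -> hball x r' y.
Proof. by move=> cx rr [cy c]; split=> //; apply: hclose_mono c. Qed.

Lemma hball_minl r s x y : cone x -> hball x (Num.min r s) y -> hball x r y.
Proof. by move=> cx; apply: hball_mono => //; rewrite ge_min lexx. Qed.

Lemma hball_minr r s x y : cone x -> hball x (Num.min r s) y -> hball x s y.
Proof. by move=> cx; apply: hball_mono => //; rewrite ge_min lexx orbT. Qed.

Lemma hball_trans r s x y z : cone x -> 1 <= r -> 1 <= s ->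
  hball x r y -> hball y s z -> hball x (r * s) z.
Proof.
move=> cx r1 s1 [cy xy] [cz yz]; split=> //; rewrite mulrC.
by apply: hclose_trans yz xy => //; lra.
Qed.

Lemma strict_max_ray p x y x' y' : same_ray x x' -> same_ray y y' ->
  strict_max p x y -> strict_max p x' y'.
Proof.
move=> [s s0 ->] [t t0 ->] hp m mp; rewrite !lformZ.
have -> : s * h m x * (t * h p y) = (s * t) * (h m x * h p y) by ring.
have -> : s * h p x * (t * h m y) = (s * t) * (h p x * h m y) by ring.
by rewrite ltr_pM2l ?mulr_gt0 ?hp.
Qed.

Lemma hball_line x0 r v : cone x0 -> 1 < r ->
  exists2 e, 0 < e & forall t, 0 <= t -> t <= e -> hball x0 r (x0 + t *: v).
Proof.
move=> c0 r1.
have [e1 e10 h1] := @small_pos _ _ (fun j => h j x0) (fun j => h j v) c0.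
(* The slack of the closeness inequality is affine in [t]: [u] is its value at [x0], [w] its
   slope. *)
pose u (ij : 'I_k * 'I_k) := (r - 1) * (h ij.1 x0 * h ij.2 x0).
pose w (ij : 'I_k * 'I_k) := r * (h ij.1 x0 * h ij.2 v) - h ij.1 v * h ij.2 x0.
have [|e2 e20 h2] := @small_pos _ _ u w.
  by move=> ij; rewrite /u !mulr_gt0 ?subr_gt0.
exists (Num.min e1 e2); first by rewrite lt_min e10.
move=> t t0; rewrite le_min => /andP[te1 te2]; split.
  by move=> j; rewrite lformD lformZ h1.
move=> i j; have := h2 t t0 te2 (i, j); rewrite /u /w /= !lformD !lformZ => hh.
nra.
Qed.

Lemma hball_line_seg x0 r v : cone x0 -> 1 < r ->
  exists2 e, 0 < e & forall t, `|t| <= e -> hball x0 r (x0 + t *: v).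
Proof.
move=> c0 r1; have [e e0 he] := hball_line v c0 r1.
have [e' e'0 he'] := hball_line (- v) c0 r1.
exists (Num.min e e'); first by rewrite lt_min e0.
move=> t; rewrite le_min => /andP[te te'].
have [t0|t0] := leP 0 t; first by apply: he => //; rewrite -(ger0_norm t0).
rewrite -[t]opprK scaleNr -scalerN.
by apply: he'; rewrite -?(ltr0_norm t0).
Qed.

Lemma strict_max_open p x y : cone x -> cone y -> strict_max p x y ->
  exists2 r, 1 < r & forall x' y', hball x r x' -> hball y r y' ->
    strict_max p x' y'.
Proof.
move=> cx cy sm.
have [||r r1 hr] := @uniform_gt R 'I_k 1 (fun m r => m != p -> forall x' y',
    hball x r x' -> hball y r y' -> h m x' * h p y' < h p x' * h m y').
- by move=> m r r' _ rr H1 mp x' y' bx by'; apply: (H1 mp); apply: hball_mono rr _.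
- move=> m; have [->|mp] := eqVneq m p; first by exists 2; rewrite ?ltr1n.
  have := sm m mp; set A := h m x * _; set B := h p x * _ => AB.
  have A0 : 0 < A by rewrite mulr_gt0.
  have B0 : 0 < B by apply: lt_trans AB.
  (* Moving both points changes the quotient by at most the factor [r * r], so [r * r * A] is kept
     below [B] by stopping at the midpoint of [A] and [B]. *)
  have [|r r1 rr] := @sqrt_gt1 R ((A + B) / (2 * A)).
    by rewrite ltr_pdivlMr ?mulr_gt0 // mul1r; lra.
  exists r => // _ x' y' [cx' hx'] [cy' hy'].
  have rAB : r * r * A < B.
    apply: (@le_lt_trans _ _ ((A + B) / 2)); last by lra.
    apply: le_trans (_ : (A + B) / (2 * A) * A <= _); first by rewrite ler_wpM2r // ltW.
    by rewrite le_eqVlt; apply/orP; left; apply/eqP; field; rewrite lt0r_neq0.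
  rewrite -(ltr_pM2r B0).
  have := ler_pM _ _ (hx' m p) (hy' p m).
  move=> /(_ (mulr_ge0 (ltW (cx' m)) (ltW (cx p))) (mulr_ge0 (ltW (cy' p)) (ltW (cy m)))) le1.
  apply: (@le_lt_trans _ _ (r * r * A * (h p x' * h m y'))).
    by apply: le_trans (_ : _ <= r * (h m x * h p x') * (r * (h p y * h m y'))) _;
      [rewrite (_ : _ * B = h m x' * h p x * (h p y' * h m y)) // /B; ring
      |rewrite /A le_eqVlt; apply/orP; left; apply/eqP; ring].
  by rewrite [X in _ < X]mulrC ltr_pM2r // mulr_gt0.
by exists r => // x' y' bx by' m mp; apply: hr.
Qed.

(** The maximum over all pairs of products of two ratios is the product of the two maxima, which are
    attained at [i] and [j]. *)
Lemma hclose_strict_max i j r x y : cone x -> cone y ->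
  strict_max i x y -> strict_max j y x ->
  hclose r x y <-> h i x * h j y <= r * (h i y * h j x).
Proof.
move=> cx cy si sj; split=> [c|c p q]; first exact: c.
have le1 : h p x * h i y <= h i x * h p y.
  by have [->|pi] := eqVneq p i; rewrite // ltW ?si.
have le2 : h q y * h j x <= h j y * h q x.
  by have [->|qj] := eqVneq q j; rewrite // ltW ?sj.
have p0 : 0 < h i y * h j x by rewrite mulr_gt0.
rewrite -(ler_pM2r p0).
apply: le_trans (_ : (h i x * h p y) * (h j y * h q x) <= _).
  have := ler_pM _ _ le1 le2.
  have -> : h p x * h i y * (h q y * h j x) = h p x * h q y * (h i y * h j x) by ring.
  by apply; rewrite mulr_ge0 // ltW.
apply: le_trans (_ : (h p y * h q x) * (r * (h i y * h j x)) <= _); last first.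
  by rewrite le_eqVlt; apply/orP; left; apply/eqP; ring.
apply: le_trans (_ : (h p y * h q x) * (h i x * h j y) <= _).
  by rewrite le_eqVlt; apply/orP; left; apply/eqP; ring.
by rewrite ler_wpM2l // mulr_ge0 // ltW.
Qed.

(** A ball contains a segment from its centre in every direction. *)
Lemma polyfun_ball_eq0 x0 r P : cone x0 -> 1 < r -> polyfun P ->
  (forall x, hball x0 r x -> P x = 0) -> forall x, P x = 0.
Proof.
move=> c0 r1 hP P0 x; have [e e0 he] := hball_line (x - x0) c0 r1.
rewrite -[x](subrK x0) addrC; apply: (@polyfun_eq0 _ _ _ _ _ e) => // t t0 te.
by apply: P0; apply: he.
Qed.

End Cone.

(** * Isometries near a visible pair of facets *)

Section Facets.
Variables (R : realType) (N k : nat) (H : 'M[R]_(N, k)) (a : 'I_k -> 'rV[R]_N).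
Implicit Types (x y z v : 'rV[R]_N) (i j m p q : 'I_k) (r c s : R).
Hypothesis fa : forall i, face H i (a i).

Local Notation h := (lform H).

Lemma facet_eq0 m i : (h m (a i) == 0) = (m == i).
Proof.
have [ai0 fai] := fa i; have [->|mi] := eqVneq m i; first by rewrite ai0 eqxx.
by rewrite gt_eqF // fai.
Qed.

Lemma facet_gt0 m i : m != i -> 0 < h m (a i).
Proof. by case: (fa i) => _; apply. Qed.

Lemma facet_ge0 m i : 0 <= h m (a i).
Proof.
have [->|/facet_gt0/ltW//] := eqVneq m i.
by case: (fa i) => ->.
Qed.

Lemma facet_self i : h i (a i) = 0. Proof. by case: (fa i). Qed.

Lemma visible_facets i j : visible H i j (a i + a j).
Proof. by exists (a i), (a j); split. Qed.

(** The identity extends to the whole space; at [a p] and at [a q] one side vanishes, which forces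
    the indices to match. *)
Lemma ratio_unique y0 r p q p' q' c : cone H y0 -> 1 < r -> p != q -> p' != q' ->
  0 < c ->
  (forall y, hball H y0 r y -> h p y * h q' y = c * (h p' y * h q y)) ->
  [/\ p = p', q = q' & c = 1].
Proof.
move=> cy r1 pq pq' c0 hb.
have E y : h p y * h q' y - c * (h p' y * h q y) = 0.
  apply: (polyfun_ball_eq0 cy r1
    (P := fun y => h p y * h q' y - c * (h p' y * h q y))) => [|z bz]; last first.
    by rewrite hb ?subrr.
  apply: polyfunD; first by apply: polyfunM; apply: lform_polyfun.
  apply: polyfunN; apply: polyfunM; first exact: polyfunC.
  by apply: polyfunM; apply: lform_polyfun.
have pp : p = p'.
  move: (E (a p)); rewrite facet_self mul0r sub0r => /eqP.
  rewrite oppr_eq0 !mulf_eq0 !facet_eq0 (gt_eqF c0) /= [q == p]eq_sym (negbTE pq) orbF.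
  by move=> /eqP.
have qq : q = q'.
  move: (E (a q)); rewrite facet_self !mulr0 subr0 => /eqP.
  rewrite !mulf_eq0 !facet_eq0 (negbTE pq) /=.
  by move=> /eqP.
split=> //; have /eqP := E y0; rewrite -pp qq.
have hp : 0 < h p y0 * h q' y0 by rewrite mulr_gt0.
rewrite -[X in X - _]mul1r -mulrBl mulf_eq0 (gt_eqF hp) orbF subr_eq0 eq_sym.
by move=> /eqP.
Qed.

(** Adding a multiple of [a p] to [y] raises every form except [h p] and breaks ties in favour of
    [p]. Subtracting a multiple of [a q] then breaks ties in favour of [q], and is small enough to
    keep the first maximum. *)
Lemma strict_max_generic x y r : cone H x -> cone H y -> 1 < r -> (0 < k)%N ->
  exists z p q, [/\ hball H y r z, strict_max H p x z & strict_max H q z x].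
Proof.
move=> cx cy r1 k0; have [s s1 ssr] := sqrt_gt1 r1.
have [p hp] := argmaxP (Ordinal k0) (fun m => h m x / h m y).
have [e e0 he] := hball_line (a p) cy s1.
pose y1 := y + e *: a p.
have by1 : hball H y s y1 by apply: he => //; apply: ltW.
have cy1 : cone H y1 by case: by1.
have sp1 : strict_max H p x y1.
  move=> m mp; rewrite /y1 !lformD !lformZ facet_self mulr0 addr0 mulrDr.
  have := hp m; rewrite ler_pdivrMr // mulrAC ler_pdivlMr // => hm.
  by apply: le_lt_trans hm _; rewrite ltrDl !mulr_gt0 // facet_gt0.
clearbody y1.
have [r2 r21 h2] := strict_max_open cx cy1 sp1.
have [q hq] := argmaxP (Ordinal k0) (fun m => h m y1 / h m x).
have m1 : 1 < Num.min s r2 by rewrite lt_min s1.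
have [e' e'0 he'] := hball_line (- a q) cy1 m1.
pose y2 := y1 + e' *: - a q.
have by2 : hball H y1 (Num.min s r2) y2 by apply: he' => //; apply: ltW.
exists y2, p, q; split.
- apply: hball_mono ssr _ => //; apply: hball_trans by1 _ => //; rewrite ?ltW //.
  by apply: hball_mono by2 => //; rewrite ge_min lexx.
- apply: h2; first exact: hball_center.
  by apply: hball_mono by2 => //; rewrite ge_min lexx orbT.
- move=> m mq; rewrite /y2 !lformD !lformZ !lformN facet_self oppr0 mulr0 addr0.
  have := hq m; rewrite ler_pdivrMr // mulrAC ler_pdivlMr // => hm.
  apply: lt_le_trans _ hm; rewrite mulrDl gtrDl mulrN mulNr oppr_lt0.
  by rewrite !mulr_gt0 // facet_gt0.
Qed.

Section Isometry.
Variable f : 'rV[R]_N -> 'rV[R]_N.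

Definition corresponds i j p q c x := h p (f x) * h j x = c * (h i x * h q (f x)).

(* The values of [f] matter only up to positive scaling. *)
Record projective_isometry : Prop := ProjectiveIsometry {
  isometry_cone : forall x, cone H x -> cone H (f x);
  isometry_close : forall r x y, cone H x -> cone H y ->
    hclose H r (f x) (f y) <-> hclose H r x y;
  isometry_onto : forall y, cone H y -> exists2 x, cone H x & same_ray (f x) y }.

Hypothesis isof : projective_isometry.

Lemma isometry_ball x r x' : cone H x -> hball H x r x' -> hball H (f x) r (f x').
Proof.
move=> cx [cx' c]; split; first exact: isometry_cone.
by apply/isometry_close.
Qed.

Lemma isometry_ball_onto x r y : cone H x -> hball H (f x) r y ->
  exists2 x', hball H x r x' & same_ray (f x') y.
Proof.
move=> cx [cy c]; have [x' cx' ry] := isometry_onto isof cy.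
exists x' => //; split=> //; apply/(isometry_close isof) => //.
by apply: hclose_rayl c; apply: same_ray_sym.
Qed.

(** For [x = u + w] with [u], [w] on the two facets, the point [2 u + w] of the chord has ratio 1 to
    [x] at [i], ratio 2 at [j], and ratios strictly in between at all other forms. *)
Lemma visible_strict_max i j x : i != j -> visible H i j x ->
  exists y, [/\ cone H y, strict_max H i x y & strict_max H j y x].
Proof.
move=> ij [u [w [[ui fu] [wj fw] ->]]].
have ji : j != i by rewrite eq_sym.
have vx : visible H i j (u + w) by exists u, w.
have vy : visible H i j (2%:R *: u + w).
  exists (2%:R *: u), w; split=> //; split; first by rewrite lformZ ui mulr0.
  by move=> m /fu hm; rewrite lformZ mulr_gt0 // ltr0n.
exists (2%:R *: u + w); split; first exact: visible_cone vy.
  move=> m mi; rewrite !lformD !lformZ ui mulr0 !add0r.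
  have := fu m mi; have wi := fw i ij => hm; rewrite mulrC ltr_pM2l //; lra.
move=> m mj; rewrite !lformD !lformZ wj !addr0.
have := fw m mj; have := fu j ji => uj wm.
rewrite mulrDl [_ * h j u]mulrC mulrDr -mulrA; nra.
Qed.

(* Both [x] and [f x] are compared with a point [y] for which the distances
   [d(x,y)] and [d(f x, f y)] are each realised by a single pair of facets, and
   stay so when [x] moves a little. *)
Lemma correspondence_local i j x : (1 < k)%N -> i != j -> visible H i j x ->
  exists p q c, [/\ p != q, 0 < c & exists2 r, 1 < r &
    forall x', hball H x r x' -> corresponds i j p q c x'].
Proof.
move=> k1 ij vx; have cx := visible_cone ij vx.
have [y0 [cy0 si0 sj0]] := visible_strict_max ij vx.
have [r1 r11 h1] := strict_max_open cx cy0 si0.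
have [r2 r21 h2] := strict_max_open cy0 cx sj0.
have cfx := isometry_cone isof cx; have cfy0 := isometry_cone isof cy0.
have m1 : 1 < Num.min r1 r2 by rewrite lt_min r11.
(* At [f y0] several facets may be maximal, so a generic nearby [z] replaces it and is pulled back
   to [y]. *)
have [z [p [q [bz sp sq]]]] := strict_max_generic cfx cfy0 m1 (ltnW k1).
have [y by0 ryz] := isometry_ball_onto cy0 bz.
have cy : cone H y by case: by0.
have cfy := isometry_cone isof cy.
have si : strict_max H i x y.
  by apply: h1; [exact: hball_center|apply: hball_mono by0; rewrite // ge_min lexx].
have sj : strict_max H j y x.
  by apply: h2; [apply: hball_mono by0; rewrite // ge_min lexx orbT|exact: hball_center].
have zry := same_ray_sym ryz.
have {}sp : strict_max H p (f x) (f y) by apply: strict_max_ray sp => //; apply: same_ray_refl.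
have {}sq : strict_max H q (f y) (f x) by apply: strict_max_ray sq => //; apply: same_ray_refl.
have pq : p != q.
  apply/eqP => pq; rewrite -pq in sq.
  have [m mp] := other_index p k1.
  by have := sp m mp; have := sq m mp; rewrite mulrC [h p _ * h m _]mulrC => h3 h4; lra.
have [s1 s11 g1] := strict_max_open cx cy si.
have [s2 s21 g2] := strict_max_open cy cx sj.
have [s3 s31 g3] := strict_max_open cfx cfy sp.
have [s4 s41 g4] := strict_max_open cfy cfx sq.
pose c := h j y * h p (f y) / (h i y * h q (f y)).
exists p, q, c; split=> //; first by rewrite divr_gt0 ?mulr_gt0 // ?cy ?cfy.
exists (Num.min (Num.min s1 s2) (Num.min s3 s4)); first by rewrite !lt_min s11 s21 s31 s41.
move=> x' bx'; have cx' : cone H x' by case: bx'.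
have cfx' := isometry_cone isof cx'.
have bb s : Num.min (Num.min s1 s2) (Num.min s3 s4) <= s -> hball H x s x'.
  by move=> hs; apply: hball_mono bx'.
have ex : strict_max H i x' y.
  by apply: g1; [apply: bb; rewrite !ge_min lexx|exact: hball_center].
have ey : strict_max H j y x'.
  by apply: g2; [exact: hball_center|apply: bb; rewrite !ge_min lexx orbT].
have efx : strict_max H p (f x') (f y).
  apply: g3; last exact: hball_center.
  by apply: isometry_ball => //; apply: bb; rewrite !ge_min lexx orbT.
have efy : strict_max H q (f y) (f x').
  apply: g4; first exact: hball_center.
  by apply: isometry_ball => //; apply: bb; rewrite !ge_min lexx !orbT.
(* Closeness is preserved at every level [r], so the two cross-ratios realising the distances are
   equal. *)
have E r : h p (f x') * h q (f y) <= r * (h p (f y) * h q (f x'))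
      <-> h i x' * h j y <= r * (h i y * h j x').
  rewrite -(hclose_strict_max r cfx' cfy efx efy) -(hclose_strict_max r cx' cy ex ey).
  exact: isometry_close.
have P1 : 0 < h p (f y) * h q (f x') by rewrite mulr_gt0 ?cfy ?cfx'.
have P2 : 0 < h i y * h j x' by rewrite mulr_gt0 ?cy ?cx'.
have e : (h p (f x') * h q (f y)) / (h p (f y) * h q (f x')) =
         (h i x' * h j y) / (h i y * h j x').
  apply/eqP; rewrite eq_le; apply/andP; split.
    by rewrite ler_pdivrMr //; apply/E; rewrite divfK ?gt_eqF.
  by rewrite ler_pdivrMr //; apply/E; rewrite divfK ?gt_eqF.
move/eqP: e; rewrite eqr_div ?lt0r_neq0 // => /eqP e.
have n1 : h i y * h q (f y) != 0 by rewrite gt_eqF // mulr_gt0 ?cy ?cfy.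
apply: (mulIf n1); rewrite [RHS]mulrAC divfK //.
transitivity (h p (f x') * h q (f y) * (h i y * h j x')); first by ring.
by rewrite e; ring.
Qed.

End Isometry.
End Facets.

(** * Irredundant families of forms *)

Section MinimalFacets.
Variables (R : realType) (N k : nat) (H : 'M[R]_(N, k)).
Local Notation h := (lform H).

(** A minimal subfamily cutting out the same open set within [U] is irredundant. With [U] the whole
    space this yields facets, with [U] the hyperplane [h i = 0] it yields the ridges of the facet
    [i]. *)
Lemma minimal_facets (U : 'rV[R]_N -> Prop) (S : {set 'I_k}) e :
  (forall x y s t, U x -> U y -> U (s *: x + t *: y)) ->
  U e -> (forall m, m \in S -> 0 < h m e) ->
  exists J : {set 'I_k}, [/\ J \subset S,
    (forall x, U x -> (forall j, j \in J -> 0 < h j x) ->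
       forall m, m \in S -> 0 < h m x) &
    forall j, j \in J -> exists x,
      [/\ U x, h j x = 0 & forall m, m \in J -> m != j -> 0 < h m x]].
Proof.
move=> Ulin Ue e0.
pose P (J : {set 'I_k}) := `[< forall x, U x -> (forall j, j \in J -> 0 < h j x) ->
  forall m, m \in S -> 0 < h m x >].
have [|J Jmin JS] := @minset_exists _ P S; first by apply/asboolP.
case/minsetP: Jmin => /asboolP PJ Jmin.
exists J; split=> // j jJ.
have : ~~ P (J :\ j).
  apply/negP => PJj; have := Jmin _ PJj (subD1set J j).
  by move/setP/(_ j); rewrite !inE eqxx jJ.
move=> /asboolPn/existsNP[x] /not_implyP[Ux] /not_implyP[xJ xS].
have hjx : h j x <= 0.
  rewrite leNgt; apply/negP => hj; apply: xS; apply: PJ => // m mJ.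
  by have [->//|mj] := eqVneq m j; apply: xJ; rewrite !inE mj.
have eS m : m \in J -> 0 < h m e by move/(fintype.subsetP JS); apply: e0.
(* Up to scaling, the point where the segment from [x] to [e] meets [h j = 0]; the other forms of
   [J] are positive at both ends. *)
exists (h j e *: x + - h j x *: e); split; first exact: Ulin.
  by rewrite lformD !lformZ; ring.
move=> m mJ mj; rewrite lformD !lformZ ltr_wpDr ?mulr_gt0 ?mulr_ge0 ?oppr_ge0 ?(ltW (eS m mJ)) //.
  exact: eS.
by apply: xJ; rewrite !inE mj.
Qed.

End MinimalFacets.

(** * The correspondence between pairs of facets *)

Section Rigidity.
Variables (R : realType) (N k : nat) (H : 'M[R]_(N, k)) (a : 'I_k -> 'rV[R]_N).
Implicit Types (x y z v : 'rV[R]_N) (i j m p q : 'I_k) (r c s : R).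
Hypothesis fa : forall i, face H i (a i).

Local Notation h := (lform H).

(** The vector [t *: v] is split into a positive multiple of [a j] and a remainder along [h i = 0];
    [kap j] balances the values of [h i]. *)
Lemma visible_near_facet i w v : face H i w -> 0 < h i v ->
  exists2 e, 0 < e & forall t, 0 < t -> t <= e -> forall j, j != i ->
    visible H i j (w + t *: v).
Proof.
move=> [wi fw] hv; pose kap j := h i v / h i (a j).
(* The dummy value 1 exempts the index [i], whose form vanishes at [w]. *)
pose u (mj : 'I_k * 'I_k) := if mj.1 == i then 1 else h mj.1 w.
pose d (mj : 'I_k * 'I_k) := h mj.1 (v - kap mj.2 *: a mj.2).
have [|e e0 he] := @small_pos _ _ u d.
  by case=> m j; rewrite /u /=; case: ifPn => // /fw.
exists e => // t t0 te j ji; exists (w + t *: (v - kap j *: a j)), ((t * kap j) *: a j).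
have ij : i != j by rewrite eq_sym.
have haj := facet_gt0 fa ij.
split; last by rewrite scalerBr scalerA -addrA subrK.
- split.
    rewrite lformD lformZ lformD lformN lformZ wi /kap divfK ?gt_eqF //; ring.
  move=> m mi; have := he t (ltW t0) te (m, j).
  by rewrite /u /= (negbTE mi) lformD lformZ.
- have k0 : 0 < t * kap j by rewrite mulr_gt0 ?divr_gt0.
  split; first by rewrite lformZ (facet_self fa) mulr0.
  by move=> m mj; rewrite lformZ mulr_gt0 // facet_gt0.
Qed.

Lemma star_point i : (1 < k)%N -> exists x, forall j, j != i -> visible H i j x.
Proof.
move=> k1; have [j ji] := other_index i k1.
have ij : i != j by rewrite eq_sym.
have [e e0 he] := visible_near_facet (fa i) (facet_gt0 fa ij).
by exists (a i + e *: a j); apply: he.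
Qed.

(* The facets in [J] are those meeting the facet [i] in a ridge; the point is close to
   the midpoint of points of the ridges of [j] and [l]. *)
Lemma triple_point i (J : {set 'I_k}) :
  (forall w, h i w = 0 -> (forall j, j \in J -> 0 < h j w) -> face H i w) ->
  (forall j, j \in J -> exists x,
      [/\ h i x = 0, h j x = 0 & forall m, m \in J -> m != j -> 0 < h m x]) ->
  i \notin J -> forall j l, j \in J -> l \in J -> j != l ->
  exists x, [/\ visible H i j x, visible H i l x & visible H j l x].
Proof.
move=> Jface ridge iJ j l jJ lJ jl.
have ji : j != i by apply: contraNneq iJ => <-.
have li : l != i by apply: contraNneq iJ => <-.
have ij : i != j by rewrite eq_sym.
have il : i != l by rewrite eq_sym.
(* A ridge point lies in the closed cone: a form negative at [x] would vanish at [x] plus a positive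
   multiple of [a i], a point where [Jface] makes it positive. *)
have ridge_ge0 m x : m \in J -> h i x = 0 -> h m x = 0 ->
    (forall m', m' \in J -> m' != m -> 0 < h m' x) -> forall m', 0 <= h m' x.
  move=> mJ xi xm xJ m'; have [->|m'i] := eqVneq m' i; first by rewrite xi.
  rewrite leNgt; apply/negP => neg.
  have am' := facet_gt0 fa m'i.
  have [|o ho|_ /(_ m' m'i)] := Jface (x + (- h m' x / h m' (a i)) *: a i).
  - by rewrite lformD lformZ xi (facet_self fa) mulr0 addr0.
  - have oi : o != i by apply: contraNneq iJ => <-.
    have t0 : 0 < - h m' x / h m' (a i) by rewrite divr_gt0 ?oppr_gt0.
    have pos : 0 < - h m' x / h m' (a i) * h o (a i) by rewrite mulr_gt0 // facet_gt0.
    rewrite lformD lformZ; have [om|om] := eqVneq o m; first by rewrite {1}om xm add0r.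
    by rewrite addr_gt0 ?xJ.
  - by rewrite lformD lformZ divfK ?gt_eqF // subrr ltxx.
have [x [xi xj xJ]] := ridge j jJ; have [y [yi yl yJ]] := ridge l lJ.
have x0 := ridge_ge0 j x jJ xi xj xJ; have y0 := ridge_ge0 l y lJ yi yl yJ.
have fxy : face H i (x + y).
  apply: Jface => [|m mJ]; first by rewrite lformD xi yi addr0.
  rewrite lformD; have [->|mj] := eqVneq m j; first by rewrite xj add0r yJ.
  by rewrite ltr_pwDl ?xJ.
have hv : 0 < h i (a j + a l) by rewrite lformD addr_gt0 ?facet_gt0.
have [e e0 he] := visible_near_facet fxy hv.
exists (x + y + e *: (a j + a l)); split; [exact: he..|].
(* For the pair [(j,l)] the same point is regrouped into one point on each of these two facets. *)
exists (x + e *: a j), (y + e *: a l); split; last by rewrite scalerDr addrACA.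
- split; first by rewrite lformD lformZ xj (facet_self fa) mulr0 addr0.
  by move=> m mj; rewrite lformD lformZ ltr_wpDl // mulr_gt0 // facet_gt0.
- split; first by rewrite lformD lformZ yl (facet_self fa) mulr0 addr0.
  by move=> m mj; rewrite lformD lformZ ltr_wpDl // mulr_gt0 // facet_gt0.
Qed.

Section Isometry.
Variable f : 'rV[R]_N -> 'rV[R]_N.
Hypothesis isof : projective_isometry H f.

Definition corresponds_near i j p q c x :=
  exists2 r, 1 < r & forall x', hball H x r x' -> corresponds H f i j p q c x'.

(** Eliminating [h i / h j] leaves an identity between ratios at image points, which fill a ball
    about [f x] up to scaling. *)
Lemma corresponds_unique i j p q c p' q' c' x : cone H x ->
  p != q -> p' != q' -> 0 < c -> 0 < c' ->
  corresponds_near i j p q c x -> corresponds_near i j p' q' c' x ->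
  [/\ p = p', q = q' & c = c'].
Proof.
move=> cx pq pq' c0 c0' [r r1 C1] [r' r1' C2].
have cc : 0 < c / c' by rewrite divr_gt0.
have m1 : 1 < Num.min r r' by rewrite lt_min r1.
have [|-> -> /divr1_eq//] := ratio_unique fa (isometry_cone isof cx) m1 pq pq' cc.
move=> y /(isometry_ball_onto isof cx)[x' bx'] ry.
have [cx' _] := bx'; have cfx' := isometry_cone isof cx'.
have [s s0 hs] := same_ray_mul ry cfx'; rewrite !hs.
have := C1 x' (hball_minl cx bx').
have := C2 x' (hball_minr cx bx').
rewrite /corresponds => e2 e1.
have n1 : h i x' * h j x' != 0 by rewrite gt_eqF // mulr_gt0.
apply: (mulIf n1); apply: (mulIf (lt0r_neq0 c0')).
transitivity (s * s * (h p (f x') * h j x') * (c' * (h i x' * h q' (f x')))); first by ring.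
by rewrite e1 -e2; field; rewrite lt0r_neq0.
Qed.

Lemma corresponds_inj i j i' j' p q c c' x : cone H x ->
  i != j -> i' != j' -> 0 < c -> 0 < c' ->
  corresponds_near i j p q c x -> corresponds_near i' j' p q c' x ->
  i = i' /\ j = j'.
Proof.
move=> cx ij ij' c0 c0' [r r1 C1] [r' r1' C2].
have cc : 0 < c' / c by rewrite divr_gt0.
have m1 : 1 < Num.min r r' by rewrite lt_min r1.
have [|-> -> //] := ratio_unique fa cx m1 ij ij' cc.
move=> x' bx'; have [cx' _] := bx'; have cfx' := isometry_cone isof cx'.
have := C1 x' (hball_minl cx bx').
have := C2 x' (hball_minr cx bx').
rewrite /corresponds => e2 e1.
apply: (mulIf (lt0r_neq0 (cfx' q))); apply: (mulIf (lt0r_neq0 c0)).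
transitivity (c * (h i x' * h q (f x')) * h j' x'); first by ring.
rewrite -e1 mulrAC e2; field; exact: lt0r_neq0.
Qed.

Lemma segment_ball x v r : cone H x -> 1 < r ->
  exists2 e, 0 < e & forall s t, `|s - t| <= e -> hball H x r (x + (s - t) *: v).
Proof.
by move=> cx r1; have [e e0 he] := hball_line_seg v cx r1; exists e => // s t; apply: he.
Qed.

(** The points seeing [(i,j)] form a convex set, and along a segment in it the triple found locally
    is constant by uniqueness. *)
Lemma correspondence i j : (1 < k)%N -> i != j ->
  exists p q c, [/\ p != q, 0 < c &
    forall x, visible H i j x -> corresponds_near i j p q c x].
Proof.
move=> k1 ij; pose x0 := a i + a j.
have v0 : visible H i j x0 := visible_facets fa i j; clearbody x0.
have [p [q [c [pq c0 C0]]]] := correspondence_local fa isof k1 ij v0.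
exists p, q, c; split=> // x vx; pose w t := x0 + t *: (x - x0).
have wE t : w t = (1 - t) *: x0 + t *: x.
  by rewrite /w scalerBr scalerBl scale1r addrCA addrC -!addrA [_ + t *: x]addrC.
have vw t : 0 <= t <= 1 -> visible H i j (w t).
  move=> /andP[t0 t1]; rewrite wE; apply: visible_convex => //; lra.
suff : corresponds_near i j p q c (w 1) by rewrite /w scale1r addrC subrK.
have [Q0 Q1] : corresponds_near i j p q c (w 0) /\ True by rewrite /w scale0r addr0.
move: Q0; apply: (locally_constant_segment (Q := fun t => corresponds_near i j p q c (w t))).
move=> t t01; have cwt := visible_cone ij (vw t t01).
have [p' [q' [c' [pq' c0' [r r1 C']]]]] := correspondence_local fa isof k1 ij (vw t t01).
have [r2 r21 r2r] := sqrt_gt1 r1.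
have [e e0 he] := segment_ball (x - x0) cwt r21.
exists e => // s s' s01 s'01 hs hs' Cs.
have wst u : w u = w t + (u - t) *: (x - x0).
  by rewrite /w -[RHS]addrA -scalerDl [t + _]addrC subrK.
have nearby u : 0 <= u <= 1 -> `|u - t| <= e -> corresponds_near i j p' q' c' (w u).
  move=> u01 /he; rewrite -wst => bu; exists r2 => // x' bx'.
  by apply: C'; apply: hball_mono r2r _ => //; apply: hball_trans bu bx' => //; apply: ltW.
have cws := visible_cone ij (vw s s01).
have [-> -> ->] := corresponds_unique cws pq pq' c0 c0' Cs (nearby s s01 hs).
exact: nearby.
Qed.

(* [(h i / h j) (h j / h l) = h i / h l] becomes a relation between products of facet
   forms along the image, whose zero sets on the facets must agree. *)
Lemma correspondence_triangle x i j l p q c p' q' c' p2 q2 c2 : cone H x ->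
  i != j -> i != l -> j != l -> p != q -> p' != q' -> p2 != q2 ->
  0 < c -> 0 < c' -> 0 < c2 ->
  corresponds_near i j p q c x -> corresponds_near i l p' q' c' x ->
  corresponds_near j l p2 q2 c2 x ->
  p = p' \/ q = q'.
Proof.
move=> cx ij il jl pq pq' pq2 c0 c0' c20 Cij Cil Cjl.
(* Equal targets for [(i,l)] and [(j,l)] would force [i = j]. *)
have neq2 : ~ (p2 = p' /\ q2 = q').
  case=> E1 E2; rewrite E1 E2 in Cjl.
  have [E _] := corresponds_inj cx jl il c20 c0' Cjl Cil.
  by rewrite E eqxx in ij.
have E y : h p y * h p2 y * h q' y * c' - c * c2 * (h q y * h q2 y * h p' y) = 0.
  case: Cij Cil Cjl => r r1 C1 [r' r1' C2] [r2 r21 C3].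
  have m1 : 1 < Num.min r (Num.min r' r2) by rewrite !lt_min r1 r1'.
  apply: (polyfun_ball_eq0 (isometry_cone isof cx) m1
    (P := fun y => h p y * h p2 y * h q' y * c' - c * c2 * (h q y * h q2 y * h p' y))).
    have pf m := lform_polyfun H m.
    by apply: polyfunD; [|apply: polyfunN]; do ?[apply: polyfunM]; do ?[exact: polyfunC].
  move=> z /(isometry_ball_onto isof cx)[x' bx'] rz.
  have [cx' _] := bx'; have cfx' := isometry_cone isof cx'.
  have [s s0 hs] := same_ray_mul rz cfx'; rewrite !hs.
  have := C1 x' (hball_minl cx bx').
  have bx2 := hball_minr cx bx'.
  have := C2 x' (hball_minl cx bx2).
  have := C3 x' (hball_minr cx bx2).
  rewrite /corresponds => e3 e2 e1.
  have n1 : h i x' * h j x' * h l x' != 0 by rewrite gt_eqF // !mulr_gt0.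
  apply: (mulIf n1); rewrite mul0r; apply/eqP.
  rewrite mulrBl subr_eq0; apply/eqP.
  transitivity (s ^+ 3 * (h p (f x') * h j x') * (h p2 (f x') * h l x') *
     (c' * (h i x' * h q' (f x')))); first by ring.
  by rewrite e1 e3 -e2; ring.
(* A product of forms vanishes at [a m] exactly when [m] is one of its indices, so [{p, p2, q'}] and
   [{q, q2, p'}] are the same set. *)
have zeros m : (p == m) || (p2 == m) || (q' == m) = (q == m) || (q2 == m) || (p' == m).
  have := E (a m); move/eqP; rewrite subr_eq0 => /eqP/(congr1 (fun u => u == 0)).
  rewrite !mulf_eq0 !(facet_eq0 fa) !(gt_eqF c0) (gt_eqF c0') (gt_eqF c20) !orbF /=.
  by [].
have [->|pp] := eqVneq p p'; first by left.
right; move: (zeros p); rewrite eqxx /= ![_ == p]eq_sym (negbTE pq) (negbTE pp) /= orbF.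
move=> /esym/eqP p_q2.
move: (zeros p'); rewrite eqxx !orbT (negbTE pp) /= [q' == p']eq_sym (negbTE pq') orbF.
move=> /eqP p2_p'.
move: (zeros q'); rewrite eqxx !orbT => /esym/orP[/orP[/eqP //|/eqP q2q']|/eqP E'].
  by case: neq2.
by rewrite E' eqxx in pq'.
Qed.

End Isometry.
End Rigidity.

(** * Rigidity *)

Section RigidityTheorem.
Variables (R : realType) (N k : nat) (H : 'M[R]_(N, k)) (a : 'I_k -> 'rV[R]_N).
Implicit Types (x y z v : 'rV[R]_N) (i j m p q : 'I_k) (r c s : R).
Hypothesis fa : forall i, face H i (a i).
Hypothesis Hfree : row_free H.
Hypothesis k_gt1 : (1 < k)%N.

Local Notation h := (lform H).

Lemma lform_eq0 x : (forall j, h j x = 0) -> x = 0.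
Proof.
move=> x0; apply: (row_free_inj Hfree); rewrite mul0mx.
by apply/rowP => j; rewrite [RHS]mxE; apply: x0.
Qed.

(* A chord through [z] in a direction close to [v] leaves the cone through the
   facets [i] and [j]; two small perturbations make both exits relative interior. *)
Lemma visible_separating i z v : cone H z -> (forall m, 0 <= h m v) -> v != 0 ->
  h i v = 0 -> exists j, [/\ i != j, visible H i j z & 0 < h j v].
Proof.
move=> cz v0 vn0 vi.
have [m1 hm1] : exists m, 0 < h m v.
  apply: contrapT => /forallNP no; case/negP: vn0; apply/eqP/lform_eq0 => j.
  by apply/eqP; rewrite eq_le v0 andbT leNgt; apply/negP/no.
pose Phi := h m1 v / h m1 z.
have Phi0 : 0 < Phi by rewrite divr_gt0.
(* So small a [t] that [t *: a i] alone never gives a ratio as large as [Phi]; hence the maximising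
   facet [j] has [h j v > 0]. *)
have [|t t0 ht] := @small_pos _ _ (fun m => Phi * h m z) (fun m => - h m (a i)).
  by move=> m; rewrite mulr_gt0.
pose v1 := v + t *: a i.
have v1i : h i v1 = 0 by rewrite lformD lformZ vi (facet_self fa) mulr0 addr0.
have v1m m : m != i -> 0 < h m v1.
  by move=> mi; rewrite lformD lformZ ltr_wpDl // mulr_gt0 // facet_gt0.
have [j hj] := argmaxP i (fun m => h m v1 / h m z).
have hjv : 0 < h j v.
  rewrite lt_def v0 andbT; apply/eqP => vj.
  have := hj m1; have := ht t (ltW t0) (lexx t) j.
  rewrite {1}/v1 ![h _ v1]lformD !lformZ vj add0r => h1.
  rewrite ler_pdivlMr // mulrDl -/Phi => h2.
  have h3 : 0 <= t * h m1 (a i) / h m1 z * h j z.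
    by rewrite mulr_ge0 ?divr_ge0 ?mulr_ge0 ?(facet_ge0 fa) //; apply: ltW.
  by rewrite mulrDl in h2; lra.
have ij : i != j by apply: contraTneq hjv => <-; rewrite vi ltxx.
have ji : j != i by rewrite eq_sym.
have hi0 : 0 < h i (a j) by apply: facet_gt0.
exists j; split=> //; clearbody v1.
(* As [phi] is the maximal ratio, [phi *: z - v1] lies on the closed facet [j]; adding [e *: a j]
   makes it relative interior, and [kap] keeps the other summand on [h i = 0]. *)
pose kap := h i (a j) / h i z; pose phi := h j v1 / h j z.
have kap0 : 0 < kap by rewrite divr_gt0.
have phi0 : 0 < phi by rewrite divr_gt0 // v1m.
have pk0 e : 0 < e -> 0 < phi + e * kap.
  by move=> e0; rewrite addr_gt0 // mulr_gt0.
have [|e e0 he] := @small_pos _ _ (fun m => if m == i then 1 else h m v1)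
                                  (fun m => h m (kap *: z - a j)).
  by move=> m; case: ifPn => // /v1m.
apply: (@visible_ray _ _ _ _ _ _ ((phi + e * kap) *: z)).
  exists (phi + e * kap)^-1; first by rewrite invr_gt0 pk0.
  by rewrite scalerA mulVf ?scale1r // gt_eqF // pk0.
exists (v1 + e *: (kap *: z - a j)), (phi *: z - v1 + e *: a j); split.
- split.
    rewrite lformD lformZ lformD lformN lformZ v1i /kap divfK ?gt_eqF //; ring.
  move=> m mi; have := he e (ltW e0) (lexx e) m.
  by rewrite (negbTE mi) lformD lformZ.
- split.
    rewrite !lformD lformN !lformZ (facet_self fa) /phi divfK ?gt_eqF //; ring.
  move=> m mj; rewrite lformD [h m (e *: _)]lformZ ltr_wpDl ?mulr_gt0 ?facet_gt0 //.
  by rewrite lformD lformN lformZ subr_ge0 -ler_pdivrMr.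
- by apply/rowP => l; rewrite !mxE; ring.
Qed.

Section Isometry.
Variable f : 'rV[R]_N -> 'rV[R]_N.
Hypothesis isof : projective_isometry H f.

(** Subtracting from [f x] the largest multiple of [x] that leaves all forms nonnegative gives a
    vector [v] with some [h i v = 0]. If [v] is nonzero, [z] sees [i] with some [j] such that
    [h j v > 0], whereas the unchanged ratio [h i / h j] gives [h j v = 0]. *)
Lemma fixed_by_visible z x : cone H z -> cone H x ->
  (forall i j, i != j -> visible H i j z -> corresponds H f i j i j 1 x) ->
  same_ray x (f x).
Proof.
move=> cz cx hv; have cy := isometry_cone isof cx.
have [i hi] := argmaxP (Ordinal (ltnW k_gt1)) (fun m => h m x / h m (f x)).
pose s := h i (f x) / h i x; have s0 : 0 < s by rewrite divr_gt0.
have [|vn0] := eqVneq (f x - s *: x) 0.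
  by move=> /eqP; rewrite subr_eq0 => /eqP ->; exists s.
have vi : h i (f x - s *: x) = 0.
  by rewrite lformD lformN lformZ /s divfK ?gt_eqF // subrr.
have v_ge0 m : 0 <= h m (f x - s *: x).
  rewrite lformD lformN lformZ subr_ge0 /s mulrAC ler_pdivrMr //.
  by have := hi m; rewrite ler_pdivrMr // mulrAC ler_pdivlMr // mulrC [X in _ <= X]mulrC.
have [j [ij vij]] := visible_separating cz v_ge0 vn0 vi.
have := hv i j ij vij; rewrite /corresponds mul1r => e.
rewrite lformD lformN lformZ subr_gt0 /s mulrAC ltr_pdivrMr // e mulrC ltxx.
by [].
Qed.

(* The set of points near which [f] is the identity is open and closed along segments. *)
Lemma isometry_rigid x0 r : cone H x0 -> 1 < r ->
  (forall x, hball H x0 r x -> same_ray x (f x)) -> forall x, cone H x -> same_ray x (f x).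
Proof.
move=> c0 r1 fix0 x cx; pose w t := x0 + t *: (x - x0).
have wE t : w t = (1 - t) *: x0 + t *: x.
  by rewrite /w scalerBr scalerBl scale1r addrCA addrC -!addrA [_ + t *: x]addrC.
have cw t : 0 <= t <= 1 -> cone H (w t).
  move=> /andP[t0 t1]; rewrite wE; apply: cone_convex => //; lra.
pose Q t := exists2 s, 1 < s & forall x', hball H (w t) s x' -> same_ray x' (f x').
suff : Q 1.
  by case=> s s1 hs; apply: hs; rewrite /w scale1r addrC subrK; apply: hball_center.
apply: (locally_constant_segment (Q := Q)); last first.
  by exists r => //; rewrite /w scale0r addr0.
move=> t t01; have cz := cw t t01; set z := w t in cz *.
have [||rho rho1 hrho] := @uniform_gt R ('I_k * 'I_k)%type 1 (fun ij rho =>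
    ij.1 != ij.2 -> visible H ij.1 ij.2 z -> exists p q c, [/\ p != q, 0 < c &
      forall x', hball H z rho x' -> corresponds H f ij.1 ij.2 p q c x']).
- move=> ij s s' _ ss hyp n v; have [p [q [c [pq cp C]]]] := hyp n v.
  by exists p, q, c; split=> // x' /(hball_mono cz ss); apply: C.
- case=> i j; have [->|ij] := eqVneq i j; first by exists 2; rewrite ?ltr1n ?eqxx.
  have [vij|nv] := pselect (visible H i j z); last by exists 2; rewrite ?ltr1n.
  have [p [q [c [pq cp [s s1 C]]]]] := correspondence_local fa isof k_gt1 ij vij.
  by exists s => // _ _; exists p, q, c.
have [rho2 rho21 rho2r] := sqrt_gt1 rho1.
have [e e0 he] := segment_ball (x - x0) cz rho21.
have wst u : w u = z + (u - t) *: (x - x0).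
  by rewrite /z /w -[RHS]addrA -scalerDl [t + _]addrC subrK.
have nearby u : `|u - t| <= e -> forall x', hball H (w u) rho2 x' -> hball H z rho x'.
  move=> /he; rewrite -wst => bu x' bx'; apply: hball_mono rho2r _ => //.
  by apply: hball_trans bu bx' => //; apply: ltW.
exists e => // s s' s01 s'01 hs hs' [rs rs1 fixs].
have cz' := cw s s01.
(* Near [w s] the map fixes rays, so uniqueness forces the pair assigned to [(i,j)] to be itself
   with constant 1; the relation then holds on the whole ball about [z]. *)
have fix_vis i j x' : i != j -> visible H i j z -> hball H z rho x' ->
    corresponds H f i j i j 1 x'.
  move=> ij vij bx'; have [p [q [c [pq cp C]]]] := hrho (i, j) ij vij.
  have m1 : 1 < Num.min rho2 rs by rewrite lt_min rho21.
  have [|pi qj c1] := ratio_unique fa cz' m1 pq ij cp; last first.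
    by have := C x' bx'; rewrite pi qj c1.
  move=> y by_; have [cy _] := by_.
  have := C y (nearby s hs y (hball_minl cz' by_)).
  have [u u0 hu] := same_ray_mul (fixs y (hball_minr cz' by_)) cy.
  rewrite /corresponds /= !hu => E; apply: (mulfI (lt0r_neq0 u0)).
  by transitivity (u * h p y * h j y); [ring|rewrite E; ring].
exists rho2 => // x' bx'; have bz := nearby s' hs' x' bx'.
apply: (fixed_by_visible cz) => [|i j ij vij]; first by case: bz.
exact: fix_vis.
Qed.

End Isometry.
End RigidityTheorem.

(** * The star of a facet *)

Section Stars.
Variables (R : realType) (N k : nat) (H : 'M[R]_(N, k)) (a : 'I_k -> 'rV[R]_N).
Implicit Types (x y z v : 'rV[R]_N) (i j m : 'I_k).
Hypothesis fa : forall i, face H i (a i).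
Hypothesis Hfree : row_free H.
Hypothesis k_gt1 : (1 < k)%N.

Local Notation h := (lform H).

(** Weight 0 lets a column drop out while the index type stays ['I_k]. *)
Lemma lform_weighted (w : 'I_k -> R) (g : 'I_k -> 'I_k) x m :
  (x *m \matrix_(s, l) (w l * H s (g l))) 0 m = w m * h (g m) x.
Proof.
rewrite /lform !mxE mulr_sumr; apply: eq_bigr => s _; rewrite mxE; ring.
Qed.

(** At each of [a i], [a j], [a m] two coefficients remain, with positive weights, so they have
    opposite signs or both vanish; three numbers cannot have pairwise opposite signs. *)
Lemma three_forms_free (u v w : R) i j m : i != j -> i != m -> j != m ->
  (forall x, u * h i x + v * h j x + w * h m x = 0) -> [/\ u = 0, v = 0 & w = 0].
Proof.
move=> ij im jm rel.
have ji : j != i by rewrite eq_sym.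
have mi : m != i by rewrite eq_sym.
have mj : m != j by rewrite eq_sym.
have := rel (a i); have := rel (a j); have := rel (a m).
rewrite !(facet_self fa) !mulr0 addr0 addr0 add0r.
have := facet_gt0 fa ij; have := facet_gt0 fa im; have := facet_gt0 fa jm.
have := facet_gt0 fa ji; have := facet_gt0 fa mi; have := facet_gt0 fa mj.
move: (h i (a j)) (h i (a m)) (h j (a m)) (h j (a i)) (h m (a i)) (h m (a j)).
move=> ij' im' jm' ji' mi' mj' H1 H2 H3 H4 H5 H6 E1 E2 E3.
have u0 : u = 0.
  have [u1|u1|//] := ltgtP u 0.
    have v1 : 0 < v by rewrite -(pmulr_lgt0 _ H4); nra.
    have w1 : 0 < w by rewrite -(pmulr_lgt0 _ H1); nra.
    have := mulr_gt0 v1 H3; have := mulr_gt0 w1 H2; lra.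
  have v1 : v < 0 by rewrite -(pmulr_llt0 _ H4); nra.
  have w1 : w < 0 by rewrite -(pmulr_llt0 _ H1); nra.
  have : v * ji' < 0 by rewrite pmulr_llt0.
  have : w * mi' < 0 by rewrite pmulr_llt0.
  lra.
rewrite u0 !mul0r !add0r in E1 E2.
split=> //; apply/eqP.
  by move/eqP: E1; rewrite mulf_eq0 (gt_eqF H4) orbF.
by move/eqP: E2; rewrite mulf_eq0 (gt_eqF H1) orbF.
Qed.

(** * The correspondences of a fixed facet on a ball *)

Section Star.
Variables (f : 'rV[R]_N -> 'rV[R]_N) (i : 'I_k) (J : {set 'I_k}).
Variables (p q : 'I_k -> 'I_k) (c : 'I_k -> R) (x0 : 'rV[R]_N) (r : R).
Hypothesis isof : projective_isometry H f.
Hypotheses (cx0 : cone H x0) (r_gt1 : 1 < r).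
Hypothesis pq_neq : forall j, j != i -> p j != q j.
Hypothesis c_gt0 : forall j, j != i -> 0 < c j.
Hypothesis star : forall j, j != i -> forall x, hball H x0 r x ->
  corresponds H f i j (p j) (q j) (c j) x.
Hypothesis iJ : i \notin J.
Hypothesis Jspan : forall x, h i x = 0 -> (forall j, j \in J -> h j x = 0) -> x = 0.

Let neq_i j : j \in J -> j != i.
Proof. by apply: contraTneq => ->. Qed.

Lemma star_inj j l : j != i -> l != i -> p j = p l -> q j = q l -> j = l.
Proof.
move=> ji li pp qq; have ij : i != j by rewrite eq_sym.
have il : i != l by rewrite eq_sym.
have Cj : corresponds_near H f i j (p j) (q j) (c j) x0 by exists r => //; apply: star.
have Cl : corresponds_near H f i l (p l) (q l) (c l) x0 by exists r => //; apply: star.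
rewrite -pp -qq in Cl.
by have [_] := corresponds_inj fa isof cx0 ij il (c_gt0 ji) (c_gt0 li) Cj Cl.
Qed.

Lemma star_scaled j x y : j != i -> hball H x0 r x -> same_ray (f x) y ->
  h (p j) y * h j x = c j * (h i x * h (q j) y).
Proof.
move=> ji bx [s s0 ->]; have := star ji bx; rewrite /corresponds !lformZ => e.
by rewrite -mulrA e; ring.
Qed.

(** With a common first index, each ratio [h j / h i] at [x] is a constant multiple of
    [h (q j) / h p0] at [f x]. The forms [h i] and [h j], [j] in [J], determine [x], so comparing
    the two coordinate systems [A] and [B] gives the linear map. *)
Lemma projective_on_ball p0 : (forall j, j \in J -> p j = p0) ->
  (exists j, j \in J) ->
  exists G : 'M[R]_N, [/\ G \in unitmx,
    forall x, h p0 (x *m G) = h i x &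
    forall x, hball H x0 r x -> same_ray (x *m G) (f x)].
Proof.
move=> pJ [j0 j0J].
pose w m := if m == i then 1 else if m \in J then (c m)^-1 else 0.
pose w' m : R := if (m == i) || (m \in J) then 1 else 0.
pose g m := if m == i then p0 else q m.
pose A := \matrix_(s, m) (w m * H s m); pose B := \matrix_(s, m) (w' m * H s (g m)).
have AE x m : (x *m A) 0 m = w m * h m x by rewrite (lform_weighted w id).
have BE x m : (x *m B) 0 m = w' m * h (g m) x by rewrite lform_weighted.
have xAB x : hball H x0 r x -> exists2 mu, 0 < mu & x *m A = mu *: (f x *m B).
  move=> bx; have [cx _] := bx; have cfx := isometry_cone isof cx.
  exists (h i x / h p0 (f x)); first by rewrite divr_gt0.
  apply/rowP => m; rewrite AE [RHS]mxE BE /w /w' /g.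
  have [->|mi] := eqVneq m i; first by rewrite /= !mul1r divfK ?gt_eqF.
  case: ifP => [mJ|_]; last by rewrite /= !mul0r mulr0.
  have := star mi bx; rewrite /corresponds pJ // => e.
  have cm := lt0r_neq0 (c_gt0 mi); have pn := lt0r_neq0 (cfx p0).
  rewrite orbT mul1r; apply: (mulfI cm); rewrite mulrA mulfV // mul1r.
  by apply: (mulfI pn); rewrite e; field.
have sAB x : hball H x0 r x -> (x *m A <= B)%MS.
  by case/xAB => mu _ ->; rewrite scalemx_sub ?submxMl.
(* Differences of points of the ball span the space. *)
have AB : (A <= B)%MS.
  apply/row_subP => s; rewrite rowE.
  have [e e0 he] := hball_line (delta_mx 0 s) cx0 r_gt1.
  have -> : delta_mx 0 s = e^-1 *: ((x0 + e *: delta_mx 0 s) - x0) :> 'rV[R]_N.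
    by rewrite addrC addKr scalerA mulVf ?scale1r // gt_eqF.
  rewrite -scalemxAl scalemx_sub // mulmxBl addmx_sub ?sAB //.
    by apply: he => //; apply: ltW.
  by rewrite -mulNmx -scaleN1r -scalemxAl scalemx_sub ?sAB //; apply: hball_center.
have Afree : row_free A.
  apply: inj_row_free => x xA0; apply: Jspan => [|j jJ].
    have := AE x i; rewrite xA0 mxE /w eqxx mul1r => <-.
    by [].
  have := AE x j; rewrite xA0 mxE /w (negbTE (neq_i jJ)) jJ => /esym/eqP.
  by rewrite mulf_eq0 invr_eq0 gt_eqF ?c_gt0 ?neq_i // => /eqP.
pose G := A *m pinvmx B.
have GB : G *m B = A by rewrite mulmxKpV.
have Bfree : row_free B.
  rewrite -row_leq_rank; apply: leq_trans (mxrankS AB).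
  by rewrite row_leq_rank.
exists G; split.
- rewrite -row_free_unit; apply: inj_row_free => x xG0.
  by apply: (row_free_inj Afree); rewrite -GB mulmxA xG0 !mul0mx.
- move=> x; have := AE x i; rewrite -GB mulmxA BE /w /w' /g eqxx /= !mul1r.
  by [].
- move=> x /xAB[mu mu0]; rewrite -GB mulmxA scalemxAl => /(row_free_inj Bfree) ->.
  exists mu^-1; first by rewrite invr_gt0.
  by rewrite scalerA mulVf ?scale1r // gt_eqF.
Qed.

(** Extended from the ball as polynomial identities, the relations show that [G] permutes the facet
    forms up to positive factors, so it preserves the cone and the distance. Then [f] followed by
    the inverse of [G] is an isometry fixing the rays of a ball, and rigidity applies. *)
Lemma projective_isometry_collineation G p0 : G \in unitmx ->
  (forall x, h p0 (x *m G) = h i x) -> (forall x, hball H x0 r x -> same_ray (x *m G) (f x)) ->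
  (forall x, cone H (x *m G) <-> cone H x) /\ forall x, cone H x -> same_ray (x *m G) (f x).
Proof.
move=> Gu p0E rayG.
have formG m x : h m (x *m G) = lform (G *m H) m x by rewrite /lform mulmxA.
have pfG m : polyfun (fun x => h m (x *m G)).
  move=> x v; have [P hP] := lform_polyfun (G *m H) m x v.
  by exists P => t; rewrite formG hP.
have onball j : j != i -> forall x, hball H x0 r x ->
    h (p j) (x *m G) * h j x = c j * (h i x * h (q j) (x *m G)).
  by move=> ji x bx; apply: star_scaled => //; apply/same_ray_sym/rayG.
have all_x j : j != i -> forall x,
    h (p j) (x *m G) * h j x - c j * (h i x * h (q j) (x *m G)) = 0.
  move=> ji; apply: (polyfun_ball_eq0 cx0 r_gt1
    (P := fun x => h (p j) (x *m G) * h j x - c j * (h i x * h (q j) (x *m G)))).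
    have pf m := lform_polyfun H m.
    by apply: polyfunD; [|apply: polyfunN]; do ?[apply: polyfunM]; do ?[exact: polyfunC].
  by move=> x /onball -> //; rewrite subrr.
(* At the point that [G] sends to [a (p j)] the relation leaves [h p0 (a (p j)) = 0]. *)
have pE j : j != i -> p j = p0.
  move=> ji; have := all_x j ji (a (p j) *m invmx G).
  rewrite mulmxKV // (facet_self fa) mul0r sub0r => /eqP.
  rewrite oppr_eq0 !mulf_eq0 (gt_eqF (c_gt0 ji)) !(facet_eq0 fa) /=.
  rewrite [_ == p j]eq_sym (negbTE (pq_neq ji)) orbF -p0E mulmxKV //.
  by rewrite (facet_eq0 fa) => /eqP.
have hE j : j != i -> forall x, h j x = c j * h (q j) (x *m G).
  move=> ji x; apply/eqP; rewrite -subr_eq0; apply/eqP; move: x.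
  apply: (polyfun_ball_eq0 cx0 r_gt1 (P := fun x => h j x - c j * h (q j) (x *m G))).
    have pf m := lform_polyfun H m.
    by apply: polyfunD; [|apply: polyfunN]; do ?[apply: polyfunM]; do ?[exact: polyfunC].
  move=> x bx; have [cx _] := bx; have := onball j ji x bx.
  rewrite pE // p0E => e; apply: (mulfI (lt0r_neq0 (cx i))).
  by rewrite mulr0 mulrBr e; ring.
pose g m := if m == i then p0 else q m.
pose w m := if m == i then 1 else c m.
have gE m x : h m x = w m * h (g m) (x *m G).
  rewrite /w /g; have [->|mi] := eqVneq m i; first by rewrite mul1r p0E.
  exact: hE.
have w_gt0 m : 0 < w m by rewrite /w; case: ifPn => // /c_gt0.
have g_inj : injective g.
  move=> m l; rewrite /g; have [->|mi] := eqVneq m i; have [->|li] := eqVneq l i => // e.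
  - by have := pq_neq li; rewrite pE // e eqxx.
  - by have := pq_neq mi; rewrite pE // e eqxx.
  - by apply: star_inj => //; rewrite !pE.
have [g' gK g'K] : bijective g by apply: injF_bij.
have coneG x : cone H (x *m G) <-> cone H x.
  split=> cx m; first by rewrite gE mulr_gt0.
  by have := cx (g' m); rewrite gE g'K pmulr_rgt0.
have closeG s x y : hclose H s (x *m G) (y *m G) <-> hclose H s x y.
  split=> cl m l.
    rewrite (gE m x) (gE l y) (gE m y) (gE l x).
    have -> : w m * h (g m) (x *m G) * (w l * h (g l) (y *m G)) =
      (w m * w l) * (h (g m) (x *m G) * h (g l) (y *m G)) by ring.
    have -> : s * (w m * h (g m) (y *m G) * (w l * h (g l) (x *m G))) =
      (w m * w l) * (s * (h (g m) (y *m G) * h (g l) (x *m G))) by ring.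
    by rewrite ler_pM2l ?mulr_gt0 //.
  have := cl (g' m) (g' l); rewrite (gE (g' m) x) (gE (g' l) y) (gE (g' m) y) (gE (g' l) x) !g'K.
  set u := w (g' m); set v := w (g' l).
  have -> : u * h m (x *m G) * (v * h l (y *m G)) =
      (u * v) * (h m (x *m G) * h l (y *m G)) by ring.
  have -> : s * (u * h m (y *m G) * (v * h l (x *m G))) =
      (u * v) * (s * (h m (y *m G) * h l (x *m G))) by ring.
  by rewrite ler_pM2l ?mulr_gt0 // /u /v.
split=> //.
have GK y : y *m invmx G *m G = y by rewrite mulmxKV.
have rayZ x y : same_ray x y -> same_ray (x *m invmx G) (y *m invmx G).
  by case=> s s0 ->; exists s; rewrite // scalemxAl.
have isog : projective_isometry H (fun x => f x *m invmx G).
  split.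
  - by move=> x /(isometry_cone isof) cfx; apply/coneG; rewrite GK.
  - by move=> s x y cx cy; rewrite -closeG !GK; apply: isometry_close.
  - move=> y /coneG/(isometry_onto isof)[x cx /rayZ]; rewrite mulmxK // => rx.
    by exists x.
have fixg x : hball H x0 r x -> same_ray x (f x *m invmx G).
  by move=> /rayG/rayZ; rewrite mulmxK.
move=> x cx; have [s s0 e] := isometry_rigid fa Hfree k_gt1 isog cx0 r_gt1 fixg cx.
by exists s => //; rewrite scalemxAl -e GK.
Qed.

(* Partial fractions: [h j / h i] is a multiple of [h q0 / h (p j)] along [f], so a
   linear relation among the facet forms makes the poles along distinct facets cancel. *)
Lemma inverted_star_absurd q0 : (2 < k)%N -> (N < k)%N ->
  (forall j, j \in J -> q j = q0) -> False.
Proof.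
move=> k_gt2 Nk qJ.
(* A form outside [i] and [J] is a combination of those in [i] and [J]; if there is none, [N < k]
   gives a relation. Either way its indices other than [i] and [m0] lie in [J]. *)
have [m0 [al [m0i al_neq0 al_supp al_rel]]] : exists m0 (al : 'I_k -> R),
  [/\ m0 != i, exists l, al l != 0,
      forall j, j \notin J -> j != i -> j != m0 -> al j = 0 &
      forall x, \sum_j al j * h j x = 0].
  have [[m [mJ mi]]|allJ] := pselect (exists m, m \notin J /\ m != i).
    pose w j : R := if (j == i) || (j \in J) then 1 else 0.
    pose A := \matrix_(s, l) (w l * H s l).
    have AE x l : (x *m A) 0 l = w l * h l x by rewrite (lform_weighted w id).
    have Afree : row_free A.
      apply: inj_row_free => x xA0; apply: Jspan => [|j jJ].
        by have := AE x i; rewrite xA0 mxE /w eqxx mul1r => <-.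
      by have := AE x j; rewrite xA0 mxE /w jJ orbT mul1r => <-.
    pose b := pinvmx A *m col m H.
    have Ab : A *m b = col m H by rewrite mulmxA mulmxVp // mul1mx.
    exists m, (fun j => w j * b j 0 - (j == m)%:R); split=> //.
    - exists m; rewrite eqxx /w (negbTE mi) (negbTE mJ) mul0r sub0r oppr_eq0.
      exact: oner_neq0.
    - by move=> j jJ ji jm; rewrite /w (negbTE ji) (negbTE jJ) (negbTE jm) mul0r subrr.
    - move=> x; under eq_bigr do rewrite mulrBl.
      rewrite sumrB [X in _ - X](bigD1 m) //= [X in _ - (_ + X)]big1 => [|j /negbTE ->].
        rewrite eqxx mul1r addr0.
        have -> : h m x = (x *m col m H) 0 0.
          by rewrite /lform !mxE; apply: eq_bigr => s _; rewrite mxE.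
        apply/eqP; rewrite subr_eq0 -Ab mulmxA [X in _ == X]mxE; apply/eqP.
        transitivity (\sum_j w j * b j 0 * h j x); first by [].
        by apply: eq_bigr => j _; rewrite AE; ring.
      by rewrite mul0r.
  have : kermx H^T != 0.
    rewrite kermx_eq0 -row_leq_rank -ltnNge; apply: leq_ltn_trans Nk.
    by rewrite rank_leq_col.
  case/matrix0Pn => s [l sl].
  have [m0 m0i] := other_index i k_gt1.
  exists m0, (fun j => kermx H^T s j); split=> //.
  - by exists l.
  - by move=> j jJ ji; case: allJ; exists j.
  - move=> x; have /rowP := sub_kermxP (row_sub s (kermx H^T)).
    move=> kerE.
    transitivity ((x *m H *m (row s (kermx H^T))^T) 0 0).
      by rewrite [RHS]mxE; apply: eq_bigr => j _; rewrite !mxE /lform !mxE mulrC.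
    have -> : x *m H *m (row s (kermx H^T))^T = x *m (row s (kermx H^T) *m H^T)^T.
      by rewrite trmx_mul trmxK mulmxA.
    by rewrite (sub_kermxP (row_sub s (kermx H^T))) trmx0 mulmx0 mxE.
pose J' := J :\ m0.
have J'J j : j \in J' -> j \in J by rewrite inE => /andP[].
have J'i j : j \in J' -> j != i by move/J'J/neq_i.
(* The relation divided by [h i x], written at [y] on the ray of [f x] and cleared of denominators;
   [m0] keeps its own [q m0], as it may lie outside [J]. *)
pose P y := al i * h (p m0) y * (\prod_(l in J') h (p l) y)
  + \sum_(j in J') al j * c j * h q0 y * h (p m0) y * (\prod_(l in J' | l != j) h (p l) y)
  + al m0 * c m0 * h (q m0) y * (\prod_(l in J') h (p l) y).
have P0 : forall y, P y = 0.
  apply: (polyfun_ball_eq0 (isometry_cone isof cx0) r_gt1 (P := P)).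
    have pf m := lform_polyfun H m.
    have pp (D : pred 'I_k) : polyfun (fun y => \prod_(l | D l) h (p l) y).
      exact: polyfun_prod.
    apply: polyfunD; first apply: polyfunD.
    - by do ?[apply: polyfunM]; do ?[exact: polyfunC].
    - apply: polyfun_sum => j.
      by do ?[apply: polyfunM]; do ?[exact: polyfunC].
    - by do ?[apply: polyfunM]; do ?[exact: polyfunC].
  move=> y by_; have [cy _] := by_.
  have [x bx rxy] := isometry_ball_onto isof cx0 by_; have [cx _] := bx.
  apply: (mulfI (lt0r_neq0 (cx i))); rewrite mulr0.
  pose Pi := \prod_(l in J') h (p l) y.
  transitivity (h (p m0) y * Pi * \sum_j al j * h j x); last by rewrite al_rel mulr0.
  rewrite (bigD1 i) //= (bigD1 m0) //=.
  have -> : \sum_(j | (j != i) && (j != m0)) al j * h j x = \sum_(j in J') al j * h j x.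
    rewrite [LHS](bigID [in J]) /= [X in _ + X]big1 ?addr0; last first.
      by move=> j /andP[/andP[ji jm] jJ]; rewrite al_supp ?mul0r.
    apply: eq_bigl => j; rewrite !inE andbC andbA; case: (boolP (j \in J)) => /= jJ.
      by rewrite neq_i // andbT.
    by rewrite andbF.
  rewrite /P -addrA !mulrDr; congr (_ + _); first by rewrite -/Pi; ring.
  rewrite addrC; congr (_ + _).
    rewrite -/Pi; have := star_scaled m0i bx rxy => e.
    transitivity (al m0 * Pi * (c m0 * (h i x * h (q m0) y))); first by ring.
    by rewrite -e; ring.
  rewrite !mulr_sumr; apply: eq_bigr => j jJ'.
  have := star_scaled (J'i j jJ') bx rxy; rewrite qJ ?J'J // => e.
  rewrite /Pi [X in _ = _ * X * _](bigD1 j) //=; move: (\prod_(l in J' | l != j) h (p l) y) => D.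
  transitivity (al j * h (p m0) y * D * (c j * (h i x * h q0 y))); first by ring.
  by rewrite -e; ring.
(* At [a (p j)] only the term of [j] survives, because [p] is injective on [J], where [q] is
   constant. *)
have al0 j : j \in J' -> p j != p m0 -> al j = 0.
  move=> jJ' pjm; have jJ := J'J j jJ'.
  have prod0 : \prod_(l in J') h (p l) (a (p j)) = 0.
    by rewrite (bigD1 j) //= (facet_self fa) mul0r.
  have := P0 (a (p j)); rewrite /P prod0 !mulr0 add0r addr0 (bigD1 j) //=.
  rewrite [X in _ + X = _ -> _]big1 ?addr0.
    move=> /eqP; rewrite !mulf_eq0 !(facet_eq0 fa) (gt_eqF (c_gt0 (neq_i jJ))).
    rewrite [p m0 == _]eq_sym (negbTE pjm) !orbF.
    have -> : (q0 == p j) = false.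
      by rewrite -(qJ j jJ) eq_sym; apply/negbTE/pq_neq/neq_i.
    rewrite orbF => /orP[/eqP //|/prodf_eq0[l /andP[lJ' lj]]].
    rewrite (facet_eq0 fa) => /eqP pp.
    have lJ := J'J l lJ'; case/eqP: lj.
    by apply: star_inj => //; rewrite ?neq_i // !qJ.
  move=> l /andP[lJ' lj]; rewrite [X in _ * X](bigD1 j) /= ?(facet_self fa) ?mul0r ?mulr0 //.
  by rewrite jJ' eq_sym lj.
(* By injectivity at most one [j] in [J'] has [p j = p m0], so the relation involves at most three
   forms, and three forms are independent. *)
have [m1 [m1i m1m0 supp1]] : exists m1, [/\ m1 != i, m1 != m0 &
    forall j, j != i -> j != m0 -> j != m1 -> al j = 0].
  have [[j [jJ' alj]]|no] := pselect (exists j, j \in J' /\ al j != 0).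
    have pj : p j = p m0 by apply/eqP; apply: contraNT alj => /(al0 j jJ') ->.
    exists j; split; [exact: J'i|by move: jJ'; rewrite !inE => /andP[]|].
    move=> l li lm lj; have [lJ|/al_supp->//] := boolP (l \in J).
    apply: al0; first by rewrite !inE lm.
    apply: contraNneq lj => pl; apply/eqP/star_inj;
      by rewrite ?neq_i ?(J'J j) ?pl ?pj ?qJ ?(J'J j).
  have [m1] : exists m1, m1 \notin [set i; m0].
    have : (0 < #|~: [set i; m0]|)%N.
      rewrite cardsCs finset.setCK card_ord subn_gt0; apply: leq_trans k_gt2.
      by rewrite ltnS cards2; case: (_ != _).
    by case/card_gt0P => m1; rewrite inE => m1P; exists m1.
  rewrite !inE negb_or => /andP[m1i m1m0]; exists m1; split=> // j ji jm _.
  have [jJ|/al_supp->//] := boolP (j \in J).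
  by apply/eqP/negPn/negP => alj; apply: no; exists j; rewrite !inE jm.
have im0 : i != m0 by rewrite eq_sym.
have im1 : i != m1 by rewrite eq_sym.
have m0m1 : m0 != m1 by rewrite eq_sym.
have [|ai am0 am1] := @three_forms_free (al i) (al m0) (al m1) i m0 m1 im0 im1 m0m1.
  move=> x; rewrite -[RHS](al_rel x) (bigD1 i) //= (bigD1 m0) //= (bigD1 m1) ?m1i //=.
  rewrite big1 ?addr0 ?addrA // => j /andP[/andP[ji jm0] jm1].
  by rewrite supp1 ?mul0r.
case: al_neq0 => l; case/negP.
have [->|li] := eqVneq l i; first by rewrite ai.
have [->|lm0] := eqVneq l m0; first by rewrite am0.
have [->|lm1] := eqVneq l m1; first by rewrite am1.
by rewrite supp1.
Qed.

End Star.

Theorem projective_isometry_linear (f : 'rV[R]_N -> 'rV[R]_N) :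
  projective_isometry H f -> (N < k)%N \/ (k <= 2)%N ->
  exists G : 'M[R]_N, [/\ G \in unitmx, forall x, cone H (x *m G) <-> cone H x &
    forall x, cone H x -> same_ray (x *m G) (f x)].
Proof.
move=> isof Nk; pose i : 'I_k := Ordinal (ltnW k_gt1).
have [x0 vx0] := star_point fa i k_gt1.
have [j ji] := other_index i k_gt1.
have cx0 : cone H x0 by apply: (visible_cone _ (vx0 j ji)); rewrite eq_sym.
(* [J] is irredundant on the hyperplane [h i = 0]: it indexes the facets meeting [i] in a ridge. *)
have [|||J [Jsub Jpos ridge]] := @minimal_facets R N k H (fun x => h i x = 0) [set~ i] (a i).
- by move=> x y s t xi yi; rewrite lformD !lformZ xi yi !mulr0 addr0.
- exact: facet_self.
- by move=> m; rewrite !inE; apply: facet_gt0.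
have iJ : i \notin J.
  by apply/negP => /(fintype.subsetP Jsub); rewrite !inE eqxx.
have neq_i l : l \in J -> l != i by apply: contraTneq => ->.
have Jface w : h i w = 0 -> (forall l, l \in J -> 0 < h l w) -> face H i w.
  move=> wi wJ; split=> // m mi; apply: Jpos => //; by rewrite !inE.
(* Moving [a i] along [x] keeps the forms in [J] positive, so no other form may reach zero on the
   way. *)
have Jspan x : h i x = 0 -> (forall l, l \in J -> h l x = 0) -> x = 0.
  move=> xi xJ; apply: (lform_eq0 Hfree) => m; have [->//|mi] := eqVneq m i.
  apply/eqP/negPn/negP => xm0.
  have [|l lJ|_ /(_ m mi)] := Jface (a i + - (h m (a i) / h m x) *: x).
  - by rewrite lformD lformZ xi mulr0 addr0 facet_self.
  - by rewrite lformD lformZ (xJ l lJ) mulr0 addr0 facet_gt0 // neq_i.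
  - by rewrite lformD lformZ mulNr divfK // subrr ltxx.
have /choice[pqc hpqc] : forall l, exists pqc : ('I_k * 'I_k * R)%type, l != i ->
    [/\ pqc.1.1 != pqc.1.2, 0 < pqc.2 & forall x, visible H i l x ->
        corresponds_near H f i l pqc.1.1 pqc.1.2 pqc.2 x].
  (* The value at [l = i] is a default; all properties are guarded by [l != i]. *)
  move=> l; have [->|li] := eqVneq l i; first by exists (i, i, 0).
  have il : i != l by rewrite eq_sym.
  have [p [q [c [pq c0 C]]]] := correspondence fa isof k_gt1 il.
  by exists (p, q, c).
pose p l := (pqc l).1.1; pose q l := (pqc l).1.2; pose c l := (pqc l).2.
have pq l : l != i -> p l != q l by move=> /hpqc[].
have c0 l : l != i -> 0 < c l by move=> /hpqc[].
have C l : l != i -> forall x, visible H i l x -> corresponds_near H f i l (p l) (q l) (c l) x.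
  by move=> /hpqc[].
have [||r r1 star] := @uniform_gt R 'I_k 1 (fun l r => l != i -> forall x, hball H x0 r x ->
    corresponds H f i l (p l) (q l) (c l) x).
- by move=> l r r' _ rr hyp li x /(hball_mono cx0 rr); apply: hyp.
- move=> l; have [->|li] := eqVneq l i; first by exists 2; rewrite ?ltr1n ?eqxx.
  by have [r r1 hr] := C l li x0 (vx0 l li); exists r.
have share l m : l \in J -> m \in J -> p l = p m \/ q l = q m.
  move=> lJ mJ; have [->|lm] := eqVneq l m; first by left.
  have [x [vl vm vlm]] := triple_point fa Jface ridge iJ lJ mJ lm.
  have [p2 [q2 [c2 [pq2 c20 C2]]]] := correspondence fa isof k_gt1 lm.
  have il : i != l by rewrite eq_sym neq_i.
  have im : i != m by rewrite eq_sym neq_i.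
  have cx := visible_cone il vl.
  exact: (correspondence_triangle fa isof cx il im lm (pq l (neq_i l lJ)) (pq m (neq_i m mJ)) pq2
    (c0 l (neq_i l lJ)) (c0 m (neq_i m mJ)) c20
    (C l (neq_i l lJ) x vl) (C m (neq_i m mJ) x vm) (C2 x vlm)).
have [j0 j0J] : exists l, l \in J.
  apply: contrapT => /forallNP J0.
  have xi : h i (h i (a j) *: a i - h i (a i) *: a j) = 0.
    by rewrite lformD lformN !lformZ (facet_self fa) mul0r mulr0 subr0.
  have ai0 : a i = 0 by apply: Jspan => [|l /J0//]; exact: facet_self.
  by have := facet_gt0 fa ji; rewrite ai0 lform0 ltxx.
have linear p0 : (forall l, l \in J -> p l = p0) ->
  exists G : 'M[R]_N, [/\ G \in unitmx, forall x, cone H (x *m G) <-> cone H x &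
    forall x, cone H x -> same_ray (x *m G) (f x)].
  move=> pJ.
  have [|G [Gu Gp Gr]] := projective_on_ball isof cx0 r1 c0 star iJ Jspan pJ; first by exists j0.
  have [cG rG] := projective_isometry_collineation isof cx0 r1 pq c0 star Gu Gp Gr.
  by exists G.
(* If [p j1] differs from [p j0], then [q j1 = q j0], and any [p l] differs from one of the two, so
   [l] shares their second index. *)
have [|/existsNP[j1 /not_implyP[j1J pj1]]] := pselect (forall l, l \in J -> p l = p j0).
  exact: linear.
have q01 : q j1 = q j0 by case: (share j1 j0 j1J j0J).
have qJ l : l \in J -> q l = q j0.
  move=> lJ; case: (share l j0 lJ j0J) => // pl0.
  case: (share l j1 lJ j1J) => [pl1|->//].
  by case: pj1; rewrite -pl1.
have j01 : j0 != j1 by apply/eqP => e; apply: pj1; rewrite e.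
have k2 : (2 < k)%N.
  have : (#|[set i; j0; j1]| <= k)%N by rewrite -[X in (_ <= X)%N]card_ord max_card.
  apply: leq_trans; rewrite -finset.setUA cardsU1 cards2 j01 !inE negb_or.
  by rewrite ![i == _]eq_sym !neq_i.
case: Nk => [Nk|]; last by rewrite leqNgt k2.
by case: (inverted_star_absurd isof cx0 r1 pq c0 star iJ Jspan k2 Nk qJ).
Qed.

End Stars.

Import numFieldNormedType.Exports.
Local Open Scope classical_set_scope.
Local Open Scope ring_scope.

(** * Linear automorphisms of the cone *)

Section LinearMaps.
Variables (R : realType) (N k : nat) (H : 'M[R]_(N, k)).
Implicit Types (u v e : 'rV[R]_N).

Local Notation h := (lform H).

Lemma nonneg_cone e v : cone H e ->
  (forall j, 0 <= h j v) <-> forall s, 0 < s -> cone H (v + s *: e).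
Proof.
move=> ce; split=> [v0 s s0 j|vs j].
  by rewrite lformD lformZ ltr_wpDl // mulr_gt0.
rewrite leNgt; apply/negP => neg.
have s0 : 0 < - h j v / h j e by rewrite divr_gt0 ?oppr_gt0.
by have := vs _ s0 j; rewrite lformD lformZ divfK ?gt_eqF // subrr ltxx.
Qed.

(** Birkhoff's description of the distance: [u] lies between [al v] and [al r v] in the order of the
    closed cone, which linear automorphisms of the cone respect. The witness [al] is the smallest
    ratio [h m u / h m v]. *)
Lemma hclose_nonneg r u v : (0 < k)%N -> cone H u -> cone H v ->
  hclose H r u v <-> exists al, [/\ 0 < al, forall j, 0 <= h j (u - al *: v) &
    forall j, 0 <= h j ((al * r) *: v - u)].
Proof.
move=> k0 cu cv; split=> [c|[al [al0 h1 h2]] i j].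
  have [j hj] := argmaxP (Ordinal k0) (fun m => h m v / h m u).
  exists (h j u / h j v); split; first by rewrite divr_gt0.
    move=> m; rewrite lformD lformN lformZ subr_ge0 mulrAC ler_pdivrMr //.
    have := hj m; rewrite ler_pdivrMr // mulrAC ler_pdivlMr // => E.
    by rewrite mulrC [leRHS]mulrC.
  move=> m; rewrite lformD lformN lformZ subr_ge0.
  have -> : h j u / h j v * r * h m v = (r * (h m v * h j u)) / h j v by ring.
  by rewrite ler_pdivlMr.
have := h1 j; have := h2 i; rewrite !lformD !lformN !lformZ !subr_ge0 => E1 E2.
have ar0 : 0 < al * r by rewrite -(pmulr_lgt0 _ (cv i)); apply: lt_le_trans E1.
have r0 : 0 < r by rewrite -(pmulr_rgt0 _ al0).
apply: le_trans (_ : al * r * h i v * h j v <= _); first by rewrite ler_pM2r.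
have -> : al * r * h i v * h j v = (r * h i v) * (al * h j v) by ring.
by rewrite mulrA ler_pM2l // mulr_gt0.
Qed.

Lemma hclose_linear (M : 'M[R]_N) r u v : (0 < k)%N ->
  (forall x, cone H (x *m M) <-> cone H x) -> cone H u -> cone H v ->
  hclose H r (u *m M) (v *m M) <-> hclose H r u v.
Proof.
move=> k0 cM cu cv.
have nonnegM w : (forall j, 0 <= h j (w *m M)) <-> (forall j, 0 <= h j w).
  rewrite (nonneg_cone w cu) (nonneg_cone (w *m M) ((cM u).2 cu)).
  by split=> hw s s0; have := hw s s0; rewrite scalemxAl -mulmxDl cM.
rewrite (hclose_nonneg r k0 ((cM u).2 cu) ((cM v).2 cv)) (hclose_nonneg r k0 cu cv).
have E1 al : u *m M - al *: (v *m M) = (u - al *: v) *m M.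
  by rewrite mulmxBl scalemxAl.
have E2 al : (al * r) *: (v *m M) - u *m M = ((al * r) *: v - u) *m M.
  by rewrite mulmxBl scalemxAl.
by split=> -[al [al0 h1 h2]]; exists al; split=> //; move: h1 h2;
  rewrite ?E1 ?E2 => /nonnegM h1 /nonnegM h2.
Qed.

End LinearMaps.

(** * Homogeneous coordinates and the Hilbert metric *)

Section Homogeneous.
Variables (R : realType) (n : nat).
Implicit Types (x y z w : 'rV[R]_n) (u v : 'rV[R]_(n + 1)).

Local Notation hom := Defs.hom.

Definition height u : R := u 0 (rshift n 0).

Definition dehom u : 'rV[R]_n := (height u)^-1 *: lsubmx u.

Lemma heightD u v : height (u + v) = height u + height v.
Proof. by rewrite /height mxE. Qed.

Lemma heightZ s u : height (s *: u) = s * height u.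
Proof. by rewrite /height mxE. Qed.

Lemma height_hom x : height (hom x) = 1.
Proof. by rewrite /height /hom row_mxEr mxE. Qed.

Lemma row_mx_height u : u = row_mx (lsubmx u) (const_mx (height u)).
Proof.
rewrite -[LHS]hsubmxK; congr row_mx; apply/rowP => s.
by rewrite !mxE ord1.
Qed.

Lemma hom_dehom u : height u != 0 -> hom (dehom u) = (height u)^-1 *: u.
Proof.
move=> u0; rewrite [X in _ = _ *: X](row_mx_height u) scale_row_mx /hom /dehom; congr row_mx.
by apply/rowP => s; rewrite !mxE ?mulVf.
Qed.

Lemma dehom_hom x : dehom (hom x) = x.
Proof. by rewrite /dehom height_hom invr1 scale1r /hom row_mxKl. Qed.

Lemma hom_inj : injective (@hom R n).
Proof. exact: can_inj dehom_hom. Qed.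

Lemma hom_line x y t : hom (x + t *: (y - x)) = hom x + t *: (hom y - hom x).
Proof.
by rewrite /hom opp_row_mx add_row_mx scale_row_mx add_row_mx addrN scaler0 addr0.
Qed.

Lemma edist_ge0 x y : 0 <= Defs.edist x y.
Proof. exact: sqrtr_ge0. Qed.

Lemma coord_edist x y i : `|x 0 i - y 0 i| <= Defs.edist x y.
Proof.
rewrite -sqrtr_sqr ler_wsqrtr // (bigD1 i) //= lerDl.
by apply: sumr_ge0 => s _; rewrite sqr_ge0.
Qed.

Lemma edist_scale x y z w c : z - w = c *: (x - y) ->
  Defs.edist z w = `|c| * Defs.edist x y.
Proof.
move=> /rowP zw; rewrite /Defs.edist -sqrtr_sqr -sqrtrM ?sqr_ge0 //; congr Num.sqrt.
rewrite mulr_sumr; apply: eq_bigr => i _.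
by have := zw i; rewrite !mxE => ->; rewrite exprMn.
Qed.

Lemma edist_gt0 x y : x != y -> 0 < Defs.edist x y.
Proof.
move=> xy; rewrite lt_def edist_ge0 andbT; apply: contraNneq xy => d0.
apply/eqP/rowP => i; apply/eqP; rewrite -subr_eq0 -normr_le0 -d0.
exact: coord_edist.
Qed.

Lemma nbhs_line (B : set 'rV[R]_n) z w : nbhs z B ->
  exists2 e, 0 < e & forall t, 0 <= t -> t <= e -> B (z + t *: w).
Proof.
move=> /nbhs_ballP[d d0 dB].
have [e e0 he] := @small_pos _ _ (fun=> d) (fun s : 'I_n => - `|w 0 s|) (fun=> d0).
exists e => // t t0 te; apply: dB; split=> // i s; rewrite ord1 -ball_normE /= !mxE.
rewrite opprD addrA subrr sub0r normrN normrM (ger0_norm t0).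
by have := he t t0 te s; rewrite mulrN subr_gt0.
Qed.

Section Forms.
Variables (k : nat) (H : 'M[R]_(n + 1, k)).

Local Notation h := (lform H).

Lemma lform_hom j x :
  h j (hom x) = \sum_(s < n) x 0 s * H (lshift 1 s) j + H (rshift n 0) j.
Proof.
rewrite /lform mxE big_split_ord /= big_ord1 row_mxEr mxE mul1r; congr (_ + _).
by apply: eq_bigr => s _; rewrite row_mxEl.
Qed.

Lemma nbhs_lform_gt0 j x : 0 < h j (hom x) ->
  nbhs x [set z | 0 < h j (hom z)].
Proof.
move=> hx; have [e e0 he] := @small_pos _ 'I_1 (fun=> h j (hom x))
  (fun=> - \sum_(s < n) `|H (lshift 1 s) j|) (fun=> hx).
apply/nbhs_ballP; exists e => //= z [_ xz].
apply: lt_le_trans (he e (ltW e0) (lexx e) ord0) _.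
rewrite !lform_hom addrAC lerD2r mulrN lerBlDr -lerBlDl -sumrB mulr_sumr.
apply: ler_sum => s _; rewrite -mulrBl; apply: le_trans (ler_norm _) _.
rewrite normrM ler_wpM2r //.
by have := xz 0 s; rewrite -ball_normE /= => /ltW.
Qed.

Lemma interior_cone_hom : [set x | cone H (hom x)]° = [set x | cone H (hom x)].
Proof.
apply/interior_id; rewrite openE => x cx.
apply: (@filter_forall _ _ (fun j => [set z | 0 < h j (hom z)]) _ (nbhs_filter x)) => j.
exact: nbhs_lform_gt0.
Qed.

End Forms.

Lemma closure_cone_hom k (H : 'M[R]_(n + 1, k)) :
  [set x | cone H (hom x)] !=set0 ->
  closure [set x | cone H (hom x)] = [set x | forall j, 0 <= lform H j (hom x)].
Proof.
move=> [e ce]; apply/seteqP; split=> x /= hx.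
  move=> j; rewrite leNgt; apply/negP => neg.
  (* A negative form of [H] is a positive form of [- H], so it stays negative on a neighbourhood. *)
  have lN m u : lform (- H) m u = - lform H m u by rewrite /lform mulmxN mxE.
  have /hx[y [/= cy]] : nbhs x [set z | 0 < lform (- H) j (hom z)].
    by apply: nbhs_lform_gt0; rewrite lN oppr_gt0.
  by rewrite lN oppr_gt0 ltNge ltW.
move=> B /(nbhs_line (e - x))[d d0 hB].
pose t := Num.min d 1.
have t0 : 0 < t by rewrite lt_min d0 ltr01.
exists (x + t *: (e - x)); split; last by apply: hB; rewrite ?ge_min ?lexx // ltW.
move=> j; rewrite hom_line lformD lformZ lformD lformN.
have := hx j; have := ce j; have t1 : t <= 1 by rewrite ge_min lexx orbT.
by move=> h1 h2; nra.
Qed.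

End Homogeneous.

(** * The Hilbert metric of a polyhedral domain *)

Section PolyhedralDomain.
Variables (R : realType) (n k : nat) (H : 'M[R]_(n + 1, k)) (X : set 'rV[R]_n).
Implicit Types (x y z w : 'rV[R]_n) (u v : 'rV[R]_(n + 1)).
Hypothesis XE : X = [set x | cone H (Defs.hom x)].
Hypothesis X0 : X !=set0.
Hypothesis Xb : ebounded X.
Hypothesis k_gt0 : (0 < k)%N.

Local Notation h := (lform H).
Local Notation hom := Defs.hom.
Local Notation edist := Defs.edist.

Lemma domainP x : X x <-> cone H (hom x). Proof. by rewrite XE. Qed.

Lemma bounded_direction x w : (forall t, 0 <= t -> X (x + t *: w)) -> w = 0.
Proof.
move=> Xt; have [r hr] := Xb.
apply/rowP => i; rewrite [RHS]mxE; apply/eqP/negPn/negP => wi.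
have r0 : 0 <= r by apply: le_trans (hr _ (Xt 0 (lexx 0))); apply: edist_ge0.
have w0 : 0 < `|w 0 i| by rewrite normr_gt0.
pose t := (r + `|x 0 i| + 1) / `|w 0 i|.
have t0 : 0 <= t by rewrite divr_ge0 // !addr_ge0.
have := le_trans (coord_edist _ _ i) (hr _ (Xt t t0)).
rewrite !mxE subr0 => le1.
have : `|t * w 0 i| <= `|x 0 i + t * w 0 i| + `|x 0 i|.
  by rewrite -[X in `|X| <= _](addKr (x 0 i)) addrC (le_trans (ler_normB _ _)).
rewrite normrM (ger0_norm t0) /t divfK ?gt_eqF // => le2; lra.
Qed.

(** At height [s <= 0], the points [(1 - t * s) *: hom x + t *: v] of the cone have height 1 and
    trace a ray in [X]. Boundedness then gives [v = s *: hom x], which is excluded since [v] is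
    nonzero with nonnegative forms. *)
Lemma height_gt0 v : v != 0 -> (forall j, 0 <= h j v) -> 0 < height v.
Proof.
move=> v0 hv; have [x Xx] := X0; have cx := (domainP x).1 Xx.
rewrite ltNge; apply/negP => s0; set s := height v in s0.
have key t : 0 <= t -> (1 - t * s) *: hom x + t *: v =
    hom (x + t *: (lsubmx v - s *: x)).
  move=> t0; rewrite [v in LHS]row_mx_height -/s /hom !scale_row_mx add_row_mx.
  congr row_mx; apply/rowP => i; rewrite !mxE; ring.
have dir : lsubmx v - s *: x = 0.
  apply: (@bounded_direction x) => t t0; apply/domainP; rewrite -key // => j.
  rewrite lformD !lformZ ltr_pwDl ?mulr_ge0 // mulr_gt0 //; nra.
have vE : v = s *: hom x.
  rewrite [LHS]row_mx_height -/s /hom scale_row_mx; congr row_mx.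
    by apply/eqP; rewrite -subr_eq0 dir.
  by apply/rowP => i; rewrite !mxE mulr1.
have := hv (Ordinal k_gt0); rewrite vE lformZ; apply/negP; rewrite -ltNge.
rewrite pmulr_llt0 ?cx // lt_def s0 andbT.
by apply: contraNneq v0 => s00; rewrite vE -s00 scale0r.
Qed.

Lemma cone_height v : cone H v -> 0 < height v.
Proof.
move=> cv; apply: height_gt0 => [|j]; last exact: ltW.
by apply: contraTneq (cv (Ordinal k_gt0)) => ->; rewrite lform0 ltxx.
Qed.

(** A nonzero common zero of the forms and its negative would both have positive height. *)
Lemma domain_row_free : row_free H.
Proof.
apply: inj_row_free => v vH; apply/eqP/negPn/negP => v0.
have hv j : h j v = 0 by rewrite /lform vH mxE.
have h1 : 0 < height v by apply: height_gt0 => // j; rewrite hv.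
have : 0 < height (-1 *: v).
  by apply: height_gt0 => [|j]; rewrite ?lformZ ?hv ?mulr0 // scaleN1r oppr_eq0.
by rewrite heightZ mulN1r oppr_gt0 => /(lt_trans h1); rewrite ltxx.
Qed.

Lemma dehom_ray v : cone H v -> same_ray v (hom (dehom v)).
Proof.
move=> cv; have v0 := cone_height cv; exists (height v)^-1; first by rewrite invr_gt0.
by rewrite hom_dehom // gt_eqF.
Qed.

Lemma dehom_domain v : cone H v -> X (dehom v).
Proof. by move=> cv; apply/domainP; apply: cone_ray (dehom_ray cv) cv. Qed.

Lemma bdryP z : bdry X z <->
  (forall j, 0 <= h j (hom z)) /\ exists j, h j (hom z) = 0.
Proof.
have Xn : [set x | cone H (hom x)] !=set0 by rewrite -XE.
rewrite /bdry XE closure_cone_hom // interior_cone_hom /=; split.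
  move=> [/= ge0 ncone]; split=> //; apply: contrapT => /forallNP no0.
  by apply: ncone => j; rewrite lt_def ge0 andbT; apply/eqP/no0.
move=> [ge0 [j j0]]; split=> //= /(_ j); by rewrite j0 ltxx.
Qed.

(* The exit point [x + s (x - y)] of the ray from [y] through [x] is determined by the
   largest ratio [h j y / h j x], which equals [(1 + s) / s]. *)
Lemma bdry_exit x y j s : X x -> X y -> x != y ->
  (forall m, h m (hom y) / h m (hom x) <= h j (hom y) / h j (hom x)) -> 0 < s ->
  bdry X (x + s *: (x - y)) <-> (1 + s) / s = h j (hom y) / h j (hom x).
Proof.
move=> /domainP cx /domainP cy xy jmax s0.
have zE m : h m (hom (x + s *: (x - y))) = (1 + s) * h m (hom x) - s * h m (hom y).
  by rewrite -opprB scalerN -scaleNr hom_line lformD lformZ lformD lformN; ring.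
have ge0E m : (0 <= h m (hom (x + s *: (x - y)))) =
    (h m (hom y) / h m (hom x) <= (1 + s) / s).
  by rewrite zE subr_ge0 ler_pdivrMr // mulrAC ler_pdivlMr // mulrC.
rewrite bdryP; split=> [[ge0 [m m0]]|e].
  have e : (1 + s) / s = h m (hom y) / h m (hom x).
    apply/eqP; rewrite (eqr_div _ _ (lt0r_neq0 s0) (lt0r_neq0 (cx m))) -subr_eq0; apply/eqP.
    by rewrite -m0 zE; ring.
  by apply/eqP; rewrite eq_le {1}e jmax -ge0E ge0.
split=> [m|]; first by rewrite ge0E e jmax.
exists j; rewrite zE; move/eqP: e.
rewrite (eqr_div _ _ (lt0r_neq0 s0) (lt0r_neq0 (cx j))) => /eqP e.
by rewrite e; ring.
Qed.

(** If no ratio exceeded 1, the ray from [x] in the direction [x - y] would never leave [X]. *)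
Lemma max_ratio_gt1 x y j : X x -> X y -> x != y ->
  (forall m, h m (hom y) / h m (hom x) <= h j (hom y) / h j (hom x)) ->
  1 < h j (hom y) / h j (hom x).
Proof.
move=> Xx Xy xy jmax; have cx := (domainP x).1 Xx.
rewrite ltNge; apply/negP => le1; case/negP: xy.
rewrite -subr_eq0; apply/eqP; apply: (@bounded_direction x) => t t0.
apply/domainP => m; rewrite -opprB scalerN -scaleNr hom_line lformD lformZ lformD lformN.
have := le_trans (jmax m) le1; rewrite ler_pdivrMr // mul1r => le2.
by have := cx m; nra.
Qed.

(** [d] is the product [a * b] of the largest ratios in the two directions. Each of them fixes one
    exit point of the line, and the cross-ratio of the four points is their product. *)
Lemma hilbert_distP x y : X x -> X y -> exists d, [/\ 1 <= d,
  hilbert_dist X x y = ln d &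
  forall r, hclose H r (hom x) (hom y) <-> d <= r].
Proof.
move=> Xx Xy; have cx := (domainP x).1 Xx; have cy := (domainP y).1 Xy.
have [i imax] := argmaxP (Ordinal k_gt0) (fun m => h m (hom x) / h m (hom y)).
have [j jmax] := argmaxP (Ordinal k_gt0) (fun m => h m (hom y) / h m (hom x)).
set a := h i (hom x) / h i (hom y) in imax.
set b := h j (hom y) / h j (hom x) in jmax.
have a0 : 0 < a by rewrite divr_gt0.
have b0 : 0 < b by rewrite divr_gt0.
have closeE r : hclose H r (hom x) (hom y) <-> a * b <= r.
  split=> [/(_ i j)|le_r p q].
    rewrite /a /b mulf_div ler_pdivrMr ?mulr_gt0 //.
  apply: le_trans (_ : a * b * (h p (hom y) * h q (hom x)) <= _); last first.
    by rewrite ler_wpM2r // mulr_ge0 // ltW.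
  have := imax p; rewrite ler_pdivrMr // => h1.
  have := jmax q; rewrite ler_pdivrMr // => h2.
  have -> : a * b * (h p (hom y) * h q (hom x)) = a * h p (hom y) * (b * h q (hom x)) by ring.
  by apply: ler_pM => //; apply: ltW.
exists (a * b); split=> //.
  have := (closeE (a * b)).2 (lexx _) i i.
  by rewrite -[X in X <= _]mul1r [h i (hom y) * _]mulrC ler_pM2r // mulr_gt0.
rewrite /hilbert_dist; case: ifPn => [/eqP xy|xy].
  by rewrite /a /b xy !divff ?gt_eqF // mulr1 ln1.
have yx : y != x by rewrite eq_sym.
have a1 : 1 < a by apply: max_ratio_gt1.
have b1 : 1 < b by apply: max_ratio_gt1.
have E0 := edist_gt0 xy.
(* Solves the exit equation for the parameter of the boundary point. *)
have exitE (c s : R) : 1 < c -> 0 < s -> (1 + s) / s = c <-> s = (c - 1)^-1.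
  move=> c1 s0; have c0 : c - 1 != 0 by rewrite subr_eq0 gt_eqF.
  split=> [<-|->]; last by field.
  have -> : (1 + s) / s - 1 = s^-1 by field; exact: lt0r_neq0.
  by rewrite invrK.
have distE (s t : R) : 0 < s -> 0 < t -> (1 + s) / s = b -> (1 + t) / t = a ->
    (edist (x + s *: (x - y)) y * edist (y + t *: (y - x)) x) /
    (edist (x + s *: (x - y)) x * edist (y + t *: (y - x)) y) = a * b.
  move=> s0 t0 <- <-.
  rewrite (@edist_scale _ _ x y (x + s *: (x - y)) y (1 + s)); last first.
    by apply/rowP => l; rewrite !mxE; ring.
  rewrite (@edist_scale _ _ x y (x + s *: (x - y)) x s); last first.
    by apply/rowP => l; rewrite !mxE; ring.
  rewrite (@edist_scale _ _ x y (y + t *: (y - x)) x (- (1 + t))); last first.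
    by apply/rowP => l; rewrite !mxE; ring.
  rewrite (@edist_scale _ _ x y (y + t *: (y - x)) y (- t)); last first.
    by apply/rowP => l; rewrite !mxE; ring.
  rewrite !normrN !gtr0_norm ?addr_gt0 //.
  by field; rewrite !lt0r_neq0.
apply: xget_unique => [|d [x' [y' [bx' by' [s s0 x'E] [t t0 y'E] ->]]]]; last first.
  rewrite x'E in bx' *; rewrite y'E in by' *; congr ln; apply: distE => //.
    by apply/(bdry_exit Xx Xy).
  by apply/(bdry_exit Xy Xx).
have s0 : 0 < (b - 1)^-1 by rewrite invr_gt0 subr_gt0.
have t0 : 0 < (a - 1)^-1 by rewrite invr_gt0 subr_gt0.
have sb : (1 + (b - 1)^-1) / (b - 1)^-1 = b by apply/exitE.
have ta : (1 + (a - 1)^-1) / (a - 1)^-1 = a by apply/exitE.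
exists (x + (b - 1)^-1 *: (x - y)), (y + (a - 1)^-1 *: (y - x)); split.
- exact/(bdry_exit Xx Xy xy jmax).
- exact/(bdry_exit Xy Xx yx imax).
- by exists (b - 1)^-1.
- by exists (a - 1)^-1.
- by rewrite distE.
Qed.

Lemma hilbert_dist_eq x y x' y' : X x -> X y -> X x' -> X y' ->
  hilbert_dist X x y = hilbert_dist X x' y' <->
  forall r, hclose H r (hom x) (hom y) <-> hclose H r (hom x') (hom y').
Proof.
move=> Xx Xy Xx' Xy'.
have [d [d1 -> dP]] := hilbert_distP Xx Xy.
have [d' [d1' -> dP']] := hilbert_distP Xx' Xy'.
have d0 : d \is Num.pos by rewrite posrE (lt_le_trans ltr01).
have d0' : d' \is Num.pos by rewrite posrE (lt_le_trans ltr01).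
split=> [/(ln_inj d0 d0') dd r|eqv]; first by rewrite dP dP' dd.
congr ln; apply/eqP; rewrite eq_le; apply/andP; split.
  by apply/dP/eqv/dP'.
by apply/dP'/eqv/dP.
Qed.

End PolyhedralDomain.

(** * Simplices *)

Section Simplex.
Variables (R : realType) (n : nat) (v : 'I_n.+1 -> 'rV[R]_n).

Local Notation hom := Defs.hom.

Definition vertex_mx : 'M[R]_(n.+1, n + 1) := \matrix_(i < n.+1) hom (v i).

Lemma mul_vertex_mx (lam : 'rV[R]_n.+1) :
  lam *m vertex_mx = \sum_i lam 0 i *: hom (v i).
Proof. by rewrite mulmx_sum_row; apply: eq_bigr => i _; rewrite rowK. Qed.

Lemma height_sum (lam : 'I_n.+1 -> R) (w : 'I_n.+1 -> 'rV[R]_n) :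
  height (\sum_i lam i *: hom (w i)) = \sum_i lam i.
Proof.
rewrite /height summxE; apply: eq_bigr => i _.
by rewrite -[LHS]/(height _) heightZ height_hom mulr1.
Qed.

Lemma hom_sum (lam : 'I_n.+1 -> R) (w : 'I_n.+1 -> 'rV[R]_n) : \sum_i lam i = 1 ->
  hom (\sum_i lam i *: w i) = \sum_i lam i *: hom (w i).
Proof.
move=> s1; rewrite [RHS]row_mx_height height_sum s1 /hom; congr row_mx.
by rewrite linear_sum; apply: eq_bigr => i _; rewrite linearZ /= /hom row_mxKl.
Qed.

(** A linear relation among the [hom (v i)] has height zero, so the coefficient of [v ord0] is minus
    the sum of the others and the relation is one among differences. *)
Lemma aff_indep_row_free : aff_indep v <-> row_free vertex_mx.
Proof.
pose D := \matrix_(i < n) (v (lift ord0 i) - v ord0).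
have key (lam : 'rV[R]_n.+1) : height (lam *m vertex_mx) = 0 ->
    lam *m vertex_mx = row_mx ((\row_i lam 0 (lift ord0 i)) *m D) 0.
  rewrite mul_vertex_mx height_sum big_ord_recl => /eqP; rewrite addr_eq0 => /eqP l0.
  rewrite big_ord_recl l0 scaleNr scaler_suml -sumrN -big_split /= mulmx_sum_row.
  have -> : row_mx (\sum_i (\row_i0 lam 0 (lift ord0 i0)) 0 i *: row i D) 0 =
      \sum_i row_mx ((\row_i0 lam 0 (lift ord0 i0)) 0 i *: row i D) (0 : 'rV[R]_1).
    elim/big_ind2: _ => [|A1 A2 B1 B2 <- <-|//]; first by rewrite row_mx0.
    by rewrite add_row_mx addr0.
  apply: eq_bigr => i _; rewrite mxE rowK /hom addrC -scalerBr.
  by rewrite opp_row_mx add_row_mx subrr scale_row_mx scaler0.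
split=> [Dfree|Wfree].
  apply: inj_row_free => lam lam0.
  have hl : height (lam *m vertex_mx) = 0 by rewrite lam0 /height mxE.
  have := key lam hl; rewrite lam0 -(row_mx0 _ _ n) => /eq_row_mx[/esym uD _].
  have u0 : \row_i lam 0 (lift ord0 i) = 0.
    by apply: (row_free_inj Dfree); rewrite uD mul0mx.
  have lS i : lam 0 (lift ord0 i) = 0 by have /rowP/(_ i) := u0; rewrite !mxE.
  apply/rowP => i; rewrite mxE; case: (unliftP ord0 i) => [j ->//|->].
  move: hl; rewrite mul_vertex_mx height_sum big_ord_recl big1 ?addr0 //.
apply: inj_row_free => u uD.
pose lam : 'rV[R]_n.+1 := \row_i oapp (fun j => u 0 j) (- \sum_j u 0 j) (unlift ord0 i).
have lS i : lam 0 (lift ord0 i) = u 0 i by rewrite mxE liftK.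
have l0 : lam 0 ord0 = - \sum_j u 0 j by rewrite mxE unlift_none.
have hl : height (lam *m vertex_mx) = 0.
  rewrite mul_vertex_mx height_sum big_ord_recl l0.
  by under [X in _ + X]eq_bigr do rewrite lS; rewrite addNr.
have uE : \row_i lam 0 (lift ord0 i) = u by apply/rowP => i; rewrite mxE lS.
have := key lam hl; rewrite uE uD row_mx0 => lam0.
have lam00 : lam = 0 by apply: (row_free_inj Wfree); rewrite lam0 mul0mx.
by rewrite -uE lam00; apply/rowP => i; rewrite !mxE.
Qed.

Hypothesis vfree : row_free vertex_mx.

(** The columns are the barycentric coordinate forms, dual to the rows [hom (v i)]. *)
Definition barycentric : 'M[R]_(n + 1, n.+1) := pinvmx vertex_mx.

Lemma vertex_mxK : vertex_mx *m barycentric = 1%:M.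
Proof. exact: mulmxVp. Qed.

Lemma barycentricK : barycentric *m vertex_mx = 1%:M.
Proof.
by apply: mulVpmx; rewrite -col_leq_rank [leqLHS]addn1; move: vfree; rewrite -row_leq_rank.
Qed.

Lemma lform_barycentric (lam : 'rV[R]_n.+1) j :
  lform barycentric j (lam *m vertex_mx) = lam 0 j.
Proof. by rewrite /lform -mulmxA vertex_mxK mulmx1. Qed.

Lemma barycentric_sum (u : 'rV[R]_(n + 1)) :
  u = \sum_i lform barycentric i u *: hom (v i).
Proof. by rewrite -mul_vertex_mx -mulmxA barycentricK mulmx1. Qed.

Lemma barycentric_vertex i j :
  lform barycentric j (hom (v i)) = (i == j)%:R.
Proof.
have -> : hom (v i) = delta_mx 0 i *m vertex_mx by rewrite -rowE rowK.
by rewrite lform_barycentric mxE eqxx eq_sym.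
Qed.

Lemma conv_hull_barycentric :
  conv_hull v = [set x | forall j, 0 <= lform barycentric j (hom x)].
Proof.
apply/seteqP; split=> x /=.
  move=> [lam [l0 l1 ->]] j; rewrite hom_sum //.
  have -> : \sum_i lam i *: hom (v i) = (\row_i lam i) *m vertex_mx.
    by rewrite mul_vertex_mx; apply: eq_bigr => i _; rewrite mxE.
  by rewrite lform_barycentric mxE.
move=> hx; have xE := barycentric_sum (hom x).
have s1 : \sum_i lform barycentric i (hom x) = 1.
  by rewrite -(height_hom x) [in RHS]xE height_sum.
exists (fun j => lform barycentric j (hom x)); split=> //.
by apply: (@hom_inj R); rewrite hom_sum.
Qed.

Lemma interior_conv_hull :
  (conv_hull v)° = [set x | cone barycentric (hom x)].
Proof.
rewrite conv_hull_barycentric; apply/seteqP; split=> x /=.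
  move=> xint j; have ge0 := interior_subset xint.
  rewrite lt_def ge0 andbT; apply/eqP => xj.
  (* Moving away from [v j] would make the vanishing coordinate negative. *)
  have [e e0 he] := nbhs_line (x - v j) xint.
  have := he e (ltW e0) (lexx e) j.
  rewrite -opprB scalerN -scaleNr hom_line lformD lformZ lformD lformN xj subr0 add0r.
  by rewrite barycentric_vertex eqxx mulr1 leNgt oppr_lt0 e0.
move=> cx; have : [set z | cone barycentric (hom z)]° x by rewrite interior_cone_hom.
by apply: interiorS => z cz j; apply: ltW.
Qed.

End Simplex.

(** * Isometries and collineations of a polyhedral domain *)

Section HilbertIsometries.
Variables (R : realType) (n : nat) (X : set 'rV[R]_n).
Hypothesis X0 : X !=set0.
Hypothesis Xb : ebounded X.

Local Notation hom := Defs.hom.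

(** Once redundant half-spaces are discarded, each homogenised form vanishes at a point where all
    the others are positive. *)
Lemma polyhedral_facets : polyhedral X ->
  exists k (H : 'M[R]_(n + 1, k)) (a : 'I_k -> 'rV[R]_(n + 1)),
    X = [set x | cone H (hom x)] /\ forall i, face H i (a i).
Proof.
move=> [k0 [al [be [_ XE]]]].
pose H0 : 'M[R]_(n + 1, k0) := \matrix_(s, j) row_mx (- al j) (const_mx (be j)) 0 s.
have hE j x : lform H0 j (hom x) = be j - dotv (al j) x.
  have Hl s : H0 (lshift 1 s) j = - al j 0 s by rewrite mxE row_mxEl mxE.
  have Hr : H0 (rshift n 0) j = be j by rewrite mxE row_mxEr mxE.
  rewrite lform_hom Hr addrC -sumrN; congr (_ + _).
  by apply: eq_bigr => s _; rewrite Hl mulrN mulrC.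
have X0E x : X x <-> cone H0 (hom x).
  by rewrite XE; split=> hx j; have := hx j; rewrite hE subr_gt0.
have [x0 /X0E cx0] := X0.
have [||J [_ Jpos ridge]] := @minimal_facets R _ k0 H0 (fun=> True) finset.setT (hom x0) _ I.
- by [].
- by [].
pose H : 'M[R]_(n + 1, #|J|) := \matrix_(s, j) H0 s (enum_val j).
have HE j u : lform H j u = lform H0 (enum_val j) u.
  by rewrite /lform !mxE; apply: eq_bigr => s _; rewrite mxE.
have /choice[a ha] : forall i : 'I_#|J|, exists u, face H i u.
  move=> i; have [u [_ ui uJ]] := ridge _ (enum_valP i); exists u.
  split; first by rewrite HE.
  by move=> m mi; rewrite HE uJ ?enum_valP // (inj_eq enum_val_inj).
exists #|J|, H, a; split=> //; apply/seteqP; split=> x /=.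
  by move=> /X0E cx j; rewrite HE.
move=> cx; apply/X0E => j; apply: Jpos => // m mJ.
by have := cx (enum_rank_in mJ m); rewrite HE enum_rankK_in.
Qed.

Section Domain.
Variables (k : nat) (H : 'M[R]_(n + 1, k)).
Hypothesis XE : X = [set x | cone H (hom x)].

Lemma facet_number_gt0 : (0 < n)%N -> (0 < k)%N.
Proof.
move=> n0; rewrite lt0n; apply/negP => /eqP k0; have [x Xx] := X0.
have w0 : const_mx 1 = 0 :> 'rV[R]_n.
  apply: (bounded_direction Xb (x := x)) => t _; rewrite XE => -[m mk].
  by exfalso; move: mk; rewrite k0.
by move/rowP/(_ (Ordinal n0)): w0; rewrite !mxE => /eqP; rewrite oner_eq0.
Qed.

Hypothesis k_gt0 : (0 < k)%N.

Let Xcone x : X x <-> cone H (hom x). Proof. by rewrite XE. Qed.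

Lemma isometry_lift f : is_isometry X f ->
  projective_isometry H (fun u => hom (f (dehom u))).
Proof.
move=> [fX fonto fd]; have XD u := dehom_domain XE X0 Xb k_gt0 (v := u).
have ray u := dehom_ray XE X0 Xb k_gt0 (v := u).
split.
- by move=> u /XD/fX/Xcone.
- move=> r u v cu cv; have := fd _ _ (XD u cu) (XD v cv).
  move=> /(hilbert_dist_eq XE X0 Xb k_gt0 (fX _ (XD u cu)) (fX _ (XD v cv))
    (XD u cu) (XD v cv))/(_ r) ->.
  split=> c; [move: (same_ray_sym (ray u cu)) (same_ray_sym (ray v cv))|
    move: (ray u cu) (ray v cv)]; by move=> ru rv; apply: (hclose_rayl ru); apply: (hclose_rayr rv).
- move=> u cu; have [x Xx fx] := fonto _ (XD u cu).
  exists (hom x); first exact/Xcone.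
  by rewrite dehom_hom fx; apply/same_ray_sym/ray.
Qed.

Lemma linear_collineation (G : 'M[R]_(n + 1)) : G \in unitmx ->
  (forall u, cone H (u *m G) <-> cone H u) -> is_collineation X G.
Proof.
move=> Gu coneG; have XD u := dehom_domain XE X0 Xb k_gt0 (v := u).
have ray u := dehom_ray XE X0 Xb k_gt0 (v := u).
split=> // [x /Xcone/coneG cx|y /Xcone cy].
  exists (dehom (hom x *m G)); first exact: XD.
  have [s s0 e] := ray _ cx; exists s^-1; first by rewrite invr_neq0 // gt_eqF.
  by rewrite e scalerA mulVf ?scale1r // gt_eqF.
have cu : cone H (hom y *m invmx G) by apply/coneG; rewrite mulmxKV.
exists (dehom (hom y *m invmx G)); first exact: XD.
have [s s0 e] := ray _ cu; exists s; first by rewrite gt_eqF.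
by rewrite e -scalemxAl mulmxKV.
Qed.

Lemma isometry_induced (a : 'I_k -> 'rV[R]_(n + 1)) f : (0 < n)%N ->
  (forall i, face H i (a i)) -> ~ (open_simplex X /\ (2 <= n)%N) ->
  (k = n.+1 -> open_simplex X) ->
  is_isometry X f -> induced_by_collineation X f.
Proof.
move=> n0 fa nsimplex square isof.
have Hfree := domain_row_free XE X0 Xb k_gt0.
have nk : (n + 1 <= k)%N by have := rank_leq_col H; rewrite (eqP Hfree).
have k1 : (1 < k)%N by apply: leq_trans nk; rewrite addn1 ltnS.
have kn : (n + 1 < k)%N \/ (k <= 2)%N.
  have [k2|k2] := leqP k 2; [by right|left].
  (* With [k > 2], the equality [k = n + 1] would make [X] a simplex of dimension at least two. *)
  rewrite ltn_neqAle nk andbT; apply/eqP => e; apply: nsimplex; split.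
    by apply: square; rewrite -e addn1.
  by move: k2; rewrite -e addn1 ltnS.
have [G [Gu coneG rayG]] := projective_isometry_linear fa Hfree k1 (isometry_lift isof) kn.
exists G; split; first exact: linear_collineation.
move=> x /Xcone/rayG; rewrite dehom_hom => -[s s0 e].
exists s^-1; first by rewrite invr_neq0 // gt_eqF.
by rewrite e scalerA mulVf ?scale1r // gt_eqF.
Qed.

Lemma proj_maps_uniq (M : 'M[R]_(n + 1)) x y z :
  proj_maps M x y -> proj_maps M x z -> y = z.
Proof.
move=> [c c0 ey] [d d0 ez]; apply: (@hom_inj R); rewrite ey in ez.
move/(congr1 (@height R n)): (ez); rewrite !heightZ !height_hom !mulr1 => cd.
by apply: (scalerI c0); rewrite ez cd.
Qed.

Lemma proj_maps_height (M : 'M[R]_(n + 1)) x y :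
  proj_maps M x y -> hom x *m M = height (hom x *m M) *: hom y.
Proof. by move=> [c c0 e]; rewrite e heightZ height_hom mulr1. Qed.

(* The height is affine and does not vanish on the convex set [X]. *)
Lemma collineation_sign (M : 'M[R]_(n + 1)) : is_collineation X M ->
  exists2 e : R, e ^+ 2 = 1 & forall x, X x -> 0 < e * height (hom x *m M).
Proof.
move=> [Mu Mto _]; pose g x := height (hom x *m M).
have g_neq0 x : X x -> g x != 0.
  by move=> /Mto[y _ [c c0 e]]; rewrite /g e heightZ height_hom mulr1.
(* [t] is the zero of the affine height on the segment, where the image would be at infinity. *)
have no_change x y : X x -> X y -> 0 < g x -> g y < 0 -> False.
  move=> Xx Xy gx gy; pose t := g x / (g x - g y).
  have d0 : 0 < g x - g y by lra.
  have t0 : 0 < t by rewrite divr_gt0.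
  have t1 : t < 1 by rewrite ltr_pdivrMr // mul1r; lra.
  have Xz : X (x + t *: (y - x)).
    apply/Xcone => j; rewrite hom_line lformD lformZ lformD lformN.
    by have := (Xcone x).1 Xx j; have := (Xcone y).1 Xy j; nra.
  have := g_neq0 _ Xz; rewrite /g hom_line mulmxDl -scalemxAl mulmxBl.
  rewrite heightD heightZ heightD -scaleN1r heightZ -/(g x) -/(g y) mulN1r.
  by rewrite /t; apply/negP; rewrite negbK; apply/eqP; field; rewrite gt_eqF.
have [x Xx] := X0; have [gx|gx|gx] := ltgtP 0 (g x).
- exists 1; first by rewrite expr1n.
  move=> y Xy; rewrite mul1r lt_def g_neq0 // leNgt; apply/negP.
  exact: no_change Xx Xy gx.
- exists (-1); first by rewrite sqrrN expr1n.
  move=> y Xy; rewrite mulN1r oppr_gt0 lt_def eq_sym g_neq0 // leNgt; apply/negP.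
  by move=> gy; apply: no_change Xy Xx gy gx.
- by have := g_neq0 x Xx; rewrite -gx eqxx.
Qed.

(** With its sign corrected, the matrix maps the cone onto itself, and such linear maps preserve
    closeness. *)
Lemma induced_isometry f : induced_by_collineation X f -> is_isometry X f.
Proof.
move=> [M [colM fM]]; have [e e1 esign] := collineation_sign colM.
have [Mu Mto Monto] := colM.
have fX x : X x -> X (f x).
  by move=> Xx; have [y Xy My] := Mto x Xx; rewrite (proj_maps_uniq (fM x Xx) My).
pose M' := e *: M.
have M'ray x : X x -> same_ray (hom (f x)) (hom x *m M').
  move=> Xx; exists (e * height (hom x *m M)); first exact: esign.
  by rewrite -scalerA -(proj_maps_height (fM x Xx)) scalemxAr.
have e0 : e != 0 by apply: contra_eq_neq e1 => ->; rewrite expr0n eq_sym oner_eq0.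
have M'inj (u w : 'rV_(n + 1)) : u *m M' = w *m M' -> u = w.
  rewrite -!scalemxAr => /(scalerI e0)/(congr1 (mulmx^~ (invmx M))).
  by rewrite !mulmxK.
have ray u := dehom_ray XE X0 Xb k_gt0 (v := u).
have XD u := dehom_domain XE X0 Xb k_gt0 (v := u).
have rayM u w : same_ray u w -> same_ray (u *m M') (w *m M').
  by move=> [s s0 ->]; exists s; rewrite // scalemxAl.
have coneM u : cone H (u *m M') <-> cone H u.
  split=> cu.
    have [x Xx Mx] := Monto _ (XD _ cu).
    have fx : f x = dehom (u *m M') := proj_maps_uniq (fM x Xx) Mx.
    have [s s0] : same_ray (hom x *m M') (u *m M').
      apply: same_ray_trans (same_ray_sym (M'ray x Xx)) _; rewrite fx.
      exact/same_ray_sym/ray.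
    rewrite scalemxAl => /M'inj ->; apply: (cone_ray _ ((Xcone x).1 Xx)).
    by exists s.
  apply: cone_ray (same_ray_trans (M'ray _ (XD u cu)) (rayM _ _ (same_ray_sym (ray u cu)))) _.
  exact/Xcone/fX/XD.
split=> //.
  move=> y /Monto[x Xx Mx]; exists x => //; exact: proj_maps_uniq (fM x Xx) Mx.
move=> x y Xx Xy; apply/(hilbert_dist_eq XE X0 Xb k_gt0 (fX x Xx) (fX y Xy) Xx Xy) => r.
have cx := (Xcone x).1 Xx; have cy := (Xcone y).1 Xy.
rewrite -(hclose_linear r k_gt0 coneM cx cy); have rx := M'ray x Xx; have ry := M'ray y Xy.
split=> c; first by apply: (hclose_rayl rx); apply: (hclose_rayr ry).
by apply: (hclose_rayl (same_ray_sym rx)); apply: (hclose_rayr (same_ray_sym ry)).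
Qed.

End Domain.

(** Here [H] is invertible; the rows of its inverse are the dual basis, span the extreme rays of the
    cone and dehomogenise to the vertices. *)
Lemma square_open_simplex k (H : 'M[R]_(n + 1, k)) :
  X = [set x | cone H (hom x)] -> k = n.+1 -> open_simplex X.
Proof.
move=> XE kn; subst k.
have k0 : (0 < n.+1)%N by [].
have Hfree := domain_row_free XE X0 Xb k0.
pose E := pinvmx H.
have HE : H *m E = 1%:M by apply: mulmxVp.
have EH : E *m H = 1%:M.
  by apply: mulVpmx; rewrite -col_leq_rank (eqP Hfree) [leqRHS]addn1.
have Eform i j : lform H j (row i E) = (i == j)%:R.
  by rewrite /lform -row_mul EH !mxE.
have ht i : 0 < height (row i E).
  apply: (height_gt0 XE X0 Xb k0) => [|j]; last by rewrite Eform ler0n.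
  apply/eqP => Ei; have := Eform i i; rewrite Ei lform0 eqxx => /esym/eqP.
  by rewrite oner_eq0.
pose v i := dehom (row i E).
have vE i : row i E = height (row i E) *: hom (v i).
  by rewrite hom_dehom ?gt_eqF // scalerA mulfV ?scale1r // gt_eqF.
have uE (u : 'rV[R]_(n + 1)) :
    u = (\row_i (lform H i u * height (row i E))) *m vertex_mx v.
  rewrite mul_vertex_mx -[LHS]mulmx1 -HE mulmxA mulmx_sum_row.
  by apply: eq_bigr => i _; rewrite [in LHS]vE scalerA [in RHS]mxE.
have vfree : row_free (vertex_mx v).
  rewrite -row_leq_rank -[leqLHS]addn1 -[X in (X <= _)%N](mxrank1 R).
  apply: mxrankS; apply/row_subP => i.
  by rewrite [row i _]uE submxMl.
exists v; split; first exact/aff_indep_row_free.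
rewrite interior_conv_hull // XE; apply/seteqP; split=> x /= cx j.
  by rewrite [hom x]uE lform_barycentric // mxE mulr_gt0.
by have := cx j; rewrite {1}[hom x]uE lform_barycentric // mxE pmulr_lgt0.
Qed.

(** Inverting all barycentric coordinates only swaps the two indices in the closeness inequalities.
    If a matrix [M] induced this map, the products of the [i]-th coordinates of [u *m M] and [u]
    would agree for all [i], which forces [M] to kill a vertex. *)
Lemma simplex_inversion : open_simplex X -> (2 <= n)%N ->
  exists2 f, is_isometry X f & ~ induced_by_collineation X f.
Proof.
move=> [v [/aff_indep_row_free vfree XE]] n2; rewrite interior_conv_hull // in XE.
set H := barycentric v in XE.
have k0 : (0 < n.+1)%N by [].
have Xcone x : X x <-> cone H (hom x) by rewrite XE.
pose inv u : 'rV[R]_(n + 1) := (\row_j (lform H j u)^-1) *m vertex_mx v.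
have invE j u : lform H j (inv u) = (lform H j u)^-1 by rewrite lform_barycentric // mxE.
have coneI u : cone H u -> cone H (inv u) by move=> cu j; rewrite invE invr_gt0.
have ray u := dehom_ray XE X0 Xb k0 (v := u).
have XD u := dehom_domain XE X0 Xb k0 (v := u).
have lform_inj u w : (forall j, lform H j u = lform H j w) -> u = w.
  move=> uw; rewrite (barycentric_sum vfree u) (barycentric_sum vfree w).
  by apply: eq_bigr => j _; rewrite uw.
have invK u : inv (inv u) = u by apply: lform_inj => j; rewrite !invE invrK.
have inv_ray u w : same_ray u w -> same_ray (inv u) (inv w).
  move=> [s s0 ->]; exists s^-1; first by rewrite invr_gt0.
  by apply: lform_inj => j; rewrite lformZ !invE lformZ invfM.
pose f x := dehom (inv (hom x)).
have fray x : X x -> same_ray (inv (hom x)) (hom (f x)).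
  by move=> /Xcone/coneI/ray.
have fX x : X x -> X (f x) by move=> /Xcone/coneI/XD.
have close_inv r x y : X x -> X y ->
    hclose H r (inv (hom x)) (inv (hom y)) <-> hclose H r (hom x) (hom y).
  move=> /Xcone cx /Xcone cy.
  have imp u w : cone H u -> cone H w -> hclose H r u w -> hclose H r (inv u) (inv w).
    move=> cu cw c i j; have := c j i; rewrite !invE.
    have p0 : 0 < lform H i u * lform H j w * (lform H j u * lform H i w).
      by rewrite !mulr_gt0.
    move=> c'; rewrite -(ler_pM2r p0).
    have -> : (lform H i u)^-1 * (lform H j w)^-1 *
      (lform H i u * lform H j w * (lform H j u * lform H i w)) =
      lform H j u * lform H i w by field; rewrite !gt_eqF.
    have -> // : r * ((lform H i w)^-1 * (lform H j u)^-1) *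
      (lform H i u * lform H j w * (lform H j u * lform H i w)) =
      r * (lform H j w * lform H i u) by field; rewrite !gt_eqF.
  split=> c; last exact: imp.
  by rewrite -(invK (hom x)) -(invK (hom y)); apply: imp => //; apply: coneI.
exists f.
  split=> //.
  - move=> y Xy; exists (f y); first exact: fX.
    apply: (@hom_inj R).
    have [s s0 e] : same_ray (hom (f (f y))) (hom y).
      apply: same_ray_trans (same_ray_sym (fray _ (fX y Xy))) _.
      by have := inv_ray _ _ (same_ray_sym (fray y Xy)); rewrite invK.
    have s1 : s = 1 by rewrite -(height_hom y) e heightZ height_hom mulr1.
    by rewrite e s1 scale1r.
  - move=> x y Xx Xy.
    apply/(hilbert_dist_eq XE X0 Xb k0 (fX x Xx) (fX y Xy) Xx Xy) => r.
    rewrite -(close_inv r x y Xx Xy); split=> c.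
      by apply: (hclose_rayl (same_ray_sym (fray x Xx)));
         apply: (hclose_rayr (same_ray_sym (fray y Xy))).
    by apply: (hclose_rayl (fray x Xx)); apply: (hclose_rayr (fray y Xy)).
move=> [M [[Mu _ _] fM]].
have [x0 /Xcone cx0] := X0.
have quad i j u : lform H i (u *m M) * lform H i u - lform H j (u *m M) * lform H j u = 0.
  have pfM m : polyfun (fun u => lform H m (u *m M)).
    move=> y w; have [P hP] := lform_polyfun (M *m H) m y w.
    by exists P => t; rewrite -hP /lform !mulmxA.
  have pf m := lform_polyfun H m.
  apply: (polyfun_ball_eq0 cx0 (ltr1n R 2)
    (P := fun u => lform H i (u *m M) * lform H i u - lform H j (u *m M) * lform H j u)).
    by apply: polyfunD; [|apply: polyfunN]; apply: polyfunM.
  move=> w [cw _]; have Xw := XD w cw.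
  have [c c0 cE] := fM _ Xw; have [s s0 sE] := fray _ Xw.
  have [t t0 tE] := same_ray_sym (ray w cw).
  have cx := (Xcone _).1 Xw.
  have prod m : lform H m (w *m M) * lform H m w = t * t * c * s.
    rewrite tE -scalemxAl cE sE !lformZ invE; field; exact: lt0r_neq0.
  by rewrite !prod subrr.
have e_form i j : lform H j (hom (v i)) = (i == j)%:R by apply: barycentric_vertex.
pose z0 : 'I_n.+1 := ord0.
have eM0 : hom (v z0) *m M = 0.
  apply: lform_inj => i; rewrite lform0.
  (* The third index exists because [n >= 2]; its form vanishes at [hom (v z0)] and [hom (v i)], so
     [quad] against [m] isolates the other product. *)
  have [m [mz mi]] : exists m, m != z0 /\ m != i.
    have : (#|pred2 z0 i| < #|'I_n.+1|)%N.
      by rewrite card_ord card2 ltnS; apply: leq_trans n2; case: (_ != _).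
    rewrite ltnNge => /negP le; apply: contrapT => /forallNP no; apply: le.
    apply: subset_leq_card; apply/fintype.subsetP => m _; rewrite inE.
    by have /not_andP[] := no m => /negP; rewrite negbK => ->; rewrite ?orbT.
  have diag l : m != l -> lform H l (hom (v l) *m M) = 0.
    move=> ml; have := quad l m (hom (v l)).
    by rewrite !e_form eqxx [l == m]eq_sym (negbTE ml) mulr1 mulr0 subr0.
  have [->|iz] := eqVneq i z0; first exact: diag.
  have := quad i m (hom (v z0) + hom (v i)).
  rewrite mulmxDl !lformD !e_form eqxx [z0 == i]eq_sym (negbTE iz) [z0 == m]eq_sym [i == m]eq_sym.
  by rewrite (negbTE mz) (negbTE mi) addr0 mulr0 subr0 add0r mulr1 diag // addr0.
have : lform H z0 (hom (v z0)) = 0.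
  by rewrite -[hom _](mulmxK Mu) eM0 mul0mx lform0.
by rewrite e_form eqxx => /eqP; rewrite oner_eq0.
Qed.

End HilbertIsometries.

Theorem theorem1p1 (R : realType) (n : nat) (X : set 'rV[R]_n) :
  polyhedral X -> X !=set0 -> ebounded X ->
  ((forall f : 'rV[R]_n -> 'rV[R]_n,
      is_isometry X f <-> induced_by_collineation X f)
   <-> ~ (open_simplex X /\ (2 <= n)%N)).
Proof.
move=> Xpoly X0 Xb; split=> [all_induced [Xs n2]|nsimplex f].
  have [f isof] := simplex_inversion X0 Xb Xs n2.
  by apply; apply/all_induced.
(* In dimension zero [X] is a single point, and the identity matrix induces every map. *)
have [n0|n0] := posnP n.
  subst n; have pt (x y : 'rV[R]_0) : x = y by apply/rowP => -[].
  have [x0 Xx0] := X0; have allX x : X x by rewrite (pt x x0).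
  split=> _; last first.
    split=> [//|y _|x y _ _]; first by exists y => //; apply: pt.
    by rewrite (pt (f x) x) (pt (f y) y).
  have maps (x y : 'rV[R]_0) : proj_maps 1%:M x y.
    by exists 1; rewrite ?oner_eq0 // mulmx1 scale1r (pt x y).
  exists 1%:M; split=> [|x _]; last exact: maps.
  by split=> [|x _|y _]; [exact: unitmx1|exists x|exists y].
have [k [H [a [XE fa]]]] := polyhedral_facets X0 Xpoly.
have k0 := facet_number_gt0 X0 Xb XE n0.
split; last exact: (induced_isometry X0 Xb XE k0).
apply: (isometry_induced X0 Xb XE k0 n0 fa nsimplex).
exact: (square_open_simplex X0 Xb XE).
Qed.
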